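(* Let $\Gamma$ be a compact quantum graph with $E$ (undirected) edges, and let $H=A^*A$ be a Laplacian on $\Gamma$ with scale-invariant local vertex conditions, where $A=d/dx$ with vertex conditions $P_vF(v)=0$ at each vertex $v$. Let $p=\sum_v\dim P_v$ be the number of Dirichlet conditions. Let $N_0=\dim\ker A^*A$ be the spectral multiplicity of $0$ for $A^*A$, let $N_0^*=\dim\ker AA^*$ be the spectral multiplicity of $0$ for the dual Laplacian $AA^*$, and let $\tilde N$ be the algebraic multiplicity of $k=0$ as a root of the secular equation $\det[U(k)-1]=0$ of $H$. Then $$\tilde N=2N_0-\operatorname{index}A=2N_0-E+p$$ and $$\tilde N=N_0+N_0^* .$$
   Context: A compact quantum graph $\Gamma$ is a metric graph (multiple edges and loops allowed) with finitely many vertices and finitely many edges, each edge being identified with an interval of finite positive length; every vertex has at least one edge attached. $d_v$ is the degree of $v$ (number of edge ends at $v$; a loop contributes two). For a function $f$ on $\Gamma$, $F(v)\in\mathbb{C}^{d_v}$ is the vector of boundary values of $f$ at $v$ along the incident edge ends, and $F'(v)$ is the vector of derivatives at $v$ taken in the directions outgoing from $v$. At each vertex $v$ an orthogonal projector $P_v$ in $\mathbb{C}^{d_v}$ is given, and $Q_v=1-P_v$; $\dim P_v$ is the dimension of its range. $A=d$ is the exterior derivative from functions $\Lambda^0(\Gamma)=L^2(\Gamma)$ to square-integrable 1-forms $\Lambda^1(\Gamma)$ (identified with $L^2(\Gamma)$, and $A$ with $d/dx$, once edges are oriented), with domain $\{f\in\bigoplus_eH^1(e):P_vF(v)=0\ \text{for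 all }v\}$. $A^*$ is its adjoint, and $\operatorname{index}A=\dim\ker A-\operatorname{codim}\operatorname{ran}A=\dim\ker A-\dim\ker A^*$. $H=A^*A$ is $-d^2/dx^2$ with domain $\{f\in\bigoplus_eH^2(e):P_vF(v)=0,\ Q_vF'(v)=0\ \text{for all }v\}$. Edge scattering matrix at $v$: let $x$ on each incident edge be the distance from $v$, and extend the edges to half-lines. For real $k\neq0$ and an incident edge end $e_0$ there is a unique function $f$ on this star with $-f''=k^2f$, $f(x)=e^{-ikx}+\sigma^{(v)}_{e_0e_0}e^{ikx}$ on $e_0$, $f(x)=\sigma^{(v)}_{e_0e}e^{ikx}$ on $e\ne e_0$, satisfying $P_vF(v)=0$, $Q_vF'(v)=0$; $\sigma^{(v)}$ is the $d_v\times d_v$ matrix of these coefficients, which is independent of $k$. Bonds are directed edges; each edge gives two bonds $\alpha,\overline\alpha$ of opposite directions, both with the length $L_\alpha=L_{\overline\alpha}$ of the edge. The global scattering matrix is the $2E\times2E$ matrix $S$ with $S_{\beta\alpha}=\sigma^{(v)}_{\beta\alpha}$ if $\alpha$ terminates at $v$ and $\beta$ starts at $v$ (the indices of $\sigma^{(v)}$ being the edge end at $v$ at which $\beta$ starts and the edge end at $v$ at which $\alpha$ terminates), and $S_{\beta\alpha}=0$ otherwise. Secular function (Kottos–Smilansky): $f(k)=\det[U(k)-1]$, where $U(k)=S\,D(k)$ and $D(k)$ is the diagonal $2E\times2E$ matrix with entries $e^{ikL_\alpha}$. $f$ is an entire function of $k$, not identically zero; $\tilde N$ is the order of vanishing of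 $f$ at $k=0$ (with $\tilde N=0$ if $f(0)\neq0$). *)

(* Defs.v *)
(* MathComp-Analysis; the scalars are R[i] for R : realType. *)
From HB Require Import structures.
From mathcomp Require Import all_boot all_order all_algebra.
From mathcomp Require Import complex.
From mathcomp Require Import all_classical all_reals all_analysis.
Set Implicit Arguments.
Unset Strict Implicit.
Unset Printing Implicit Defensive.
Import Order.TTheory GRing.Theory Num.Theory.
Import numFieldNormedType.Exports.
Local Open Scope classical_set_scope.
Local Open Scope ring_scope.
Local Open Scope complex_scope.

(* Edge e is identified with the interval [0, len e]. The pair (e, false)
   denotes its end at 0 and (e, true) its end at len e; [endpoint] gives the
   vertex at which an edge end is attached. *)
Record quantum_graph (R : realType) := QuantumGraph {
  vertex : finType;
  edge : finType;
  endpoint : edge * bool -> vertex;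
  len : edge -> R;
  len_gt0 : forall e, 0 < len e;
  endpoint_surj : forall v, exists d, endpoint d = v
}.

Section QuantumGraph.
Context (R : realType) (G : quantum_graph R).

Definition ends (v : vertex G) : {set edge G * bool} :=
  [set d | endpoint d == v].

Definition degree (v : vertex G) : nat := #|ends v|.

Definition orthogonal_projector n (P : 'M[R[i]]_n) : Prop :=
  P *m P = P /\ (P ^t*)%sesqui = P.

(* The projector at v acts on C^(d_v), whose coordinates are the edge ends at
   v in the order of [enum_val]. *)
Definition vertex_conditions := forall v : vertex G, 'M[R[i]]_(degree v).

Definition graph_fun := edge G -> R -> R[i].

Definition end_value (f : graph_fun) (d : edge G * bool) : R[i] :=
  f d.1 (if d.2 then len d.1 else 0).

Definition boundary_values (f : graph_fun) (v : vertex G) :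
    'cV[R[i]]_(degree v) :=
  \col_i end_value f (@enum_val _ (mem (ends v)) i).

Definition complex_integral (D : set R) (h : R -> R[i]) : R[i] :=
  Rintegral (@lebesgue_measure R) D (fun x => complex.Re (h x)) +i*
  Rintegral (@lebesgue_measure R) D (fun x => complex.Im (h x)).

(* L^2 functions are handled through representatives: among these, the relations
   and subspaces below are invariant under almost everywhere equality, and
   kernels and ranges are measured modulo a space containing the null
   functions. *)
Definition L2 (f : graph_fun) : Prop := forall e,
  ((fun x => complex.Re (f e x)) \* \1_(`[0%R, len e]%classic)
     \in Lfun (@lebesgue_measure R) 2%:E) /\
  ((fun x => complex.Im (f e x)) \* \1_(`[0%R, len e]%classic)
     \in Lfun (@lebesgue_measure R) 2%:E).

Definition ae_equal (f g : graph_fun) : Prop := forall e,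
  f e = g e %[ae (@lebesgue_measure R) in `[0, len e]%classic].

Definition inner (f g : graph_fun) : R[i] :=
  \sum_e complex_integral `[0, len e]%classic (fun x => f e x * (g e x)^*).

Definition graph_fun0 : graph_fun := fun _ _ => 0.

(* X and W are subspaces with W included in X; n = dim (X / W). *)
Definition quotient_dim (X W : set graph_fun) (n : nat) : Prop :=
  exists b : 'I_n -> graph_fun,
  [/\ forall i, X (b i),
      forall c : 'I_n -> R[i],
        W (fun e x => \sum_i c i * b i e x) -> forall i, c i = 0
    & forall f, X f -> exists c : 'I_n -> R[i],
        W (fun e x => f e x - \sum_i c i * b i e x)].

(* Unbounded operators in L^2 are given by their graphs: T f g stands for
   "f is in the domain of T and T f = g". *)
Definition operator := graph_fun -> graph_fun -> Prop.

Definition kernel_dim (T : operator) (n : nat) : Prop :=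
  quotient_dim [set f | T f graph_fun0] [set f | ae_equal f graph_fun0] n.

Definition range_codim (T : operator) (n : nat) : Prop :=
  quotient_dim [set g | L2 g] [set g | exists f, T f g] n.

Definition operator_index (T : operator) (j : int) : Prop :=
  exists a c : nat,
  [/\ kernel_dim T a, range_codim T c & j = a%:Z - c%:Z].

Definition adjoint (T : operator) : operator := fun g h =>
  [/\ L2 g, L2 h & forall f f', T f f' -> inner f' g = inner f h].

Definition compose (S T : operator) : operator := fun f h =>
  exists2 g, T f g & S g h.

(* f0 is the absolutely continuous representative of f in H^1 with L^2
   derivative g; the boundary values of f are those of f0. One-forms are
   identified with functions by means of the coordinate of each edge. *)
Definition extd (P : vertex_conditions) : operator := fun f g =>
  [/\ L2 f, L2 g & exists f0 : graph_fun,
    [/\ ae_equal f f0,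
        forall (e : edge G) (x : R), 0 <= x <= len e ->
          f0 e x = f0 e 0 + complex_integral `[0, x]%classic (g e)
      & forall v, P v *m boundary_values f0 v = 0]].

Definition cexp (z : R[i]) : R[i] :=
  (expR (complex.Re z))%:C * (cos (complex.Im z) +i* sin (complex.Im z)).

Definition cderive1 (h : R -> R[i]) (x : R) : R[i] :=
  derive1 (fun y => complex.Re (h y)) x +i*
  derive1 (fun y => complex.Im (h y)) x.

(* The component along the edge end i, as a function of the distance from the
   vertex, of the wave coming in along i0. *)
Definition star_wave n (s : 'M[R[i]]_n) (k : R) (i0 i : 'I_n) (x : R) : R[i] :=
  (i == i0)%:R * cexp (- ('i%C * k%:C * x%:C)) + s i0 i * cexp ('i%C * k%:C * x%:C).

Definition is_vertex_scattering n (P s : 'M[R[i]]_n) : Prop :=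
  forall k : R, k != 0 -> forall i0 : 'I_n,
    P *m (\col_i star_wave s k i0 i 0) = 0 /\
    (1%:M - P) *m (\col_i cderive1 (star_wave s k i0 i) 0) = 0.

(* For an orthogonal projector P there is exactly one such matrix. *)
Definition vertex_scattering n (P : 'M[R[i]]_n) : 'M[R[i]]_n :=
  xget 0 [set s | is_vertex_scattering P s].

Lemma mem_ends (d : edge G * bool) : d \in ends (endpoint d).
Proof. by rewrite inE. Qed.

(* The index, among the edge ends at the vertex of d, of the edge end d'
   (which is meant to be attached to the same vertex). *)
Definition end_index (d d' : edge G * bool) : 'I_(degree (endpoint d)) :=
  enum_rank_in (mem_ends d) d'.

(* A bond is represented by the edge end at which it starts. *)
Definition bond := (edge G * bool)%type.

Definition bond_start (a : bond) : edge G * bool := a.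
Definition bond_end (a : bond) : edge G * bool := (a.1, ~~ a.2).

(* The first index of [vertex_scattering] is the incoming edge end; reading the
   entries with the two indices exchanged leaves [secular] unchanged, since the
   resulting evolution operator is similar to the transpose of this one. *)
Definition scattering_entry (P : vertex_conditions) (b a : bond) : R[i] :=
  if endpoint (bond_start b) == endpoint (bond_end a) then
    vertex_scattering (P (endpoint (bond_start b)))
      (end_index (bond_start b) (bond_start b))
      (end_index (bond_start b) (bond_end a))
  else 0.

Definition scattering_matrix (P : vertex_conditions) : 'M[R[i]]_#|{: bond}| :=
  \matrix_(j, l) scattering_entry P (enum_val j) (enum_val l).

Definition evolution (P : vertex_conditions) (k : R[i]) :
    'M[R[i]]_#|{: bond}| :=
  scattering_matrix P *m
  diag_mx (\row_j cexp ('i%C * k * (len (enum_val j : bond).1)%:C)).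

Definition secular (P : vertex_conditions) (k : R[i]) : R[i] :=
  \det (evolution P k - 1%:M).

(* Derivability of g on R[i]^o is complex differentiability. *)
Definition vanishing_order0 (f : R[i] -> R[i]) (n : nat) : Prop :=
  exists g : R[i]^o -> R[i]^o,
  [/\ \forall k \near (0 : R[i]^o), derivable g k 1,
      g 0 != 0
    & \forall k \near (0 : R[i]^o), f k = k ^+ n * g k].

Definition dirichlet_count (P : vertex_conditions) : nat :=
  (\sum_v \rank (P v))%N.

End QuantumGraph.

(* Main.v *)
(** Let Pi be the orthogonal projector of C^(2E) assembled from the P_v, let J
    exchange the two ends of every edge, and let Sy and As be the spaces of
    boundary vectors that J fixes, respectively negates.  Elements of ker A are
    edgewise constant and correspond to Sy /\ ker Pi; those of ker A^* are
    edgewise constant as well and correspond to As /\ ran Pi.  As is the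
    orthogonal complement of Sy, so counting dimensions gives
    dim ker A + p = E + dim ker A^*; integrating over each edge identifies the
    cokernel of A with ran Pi / Pi(Sy).

    The vertex scattering matrices are 1 - 2 P_v, so U(0) = (1 - 2 Pi) J is a
    product of two reflections, and its fixed space is
    (Sy /\ ker Pi) + (As /\ ran Pi), of dimension N0 + N0^*.  It remains to see
    that det (U(k) - 1) vanishes at 0 exactly to the order d = dim ker (U(0) - 1).
    Gaussian elimination of U(0) - 1 extracts the factor k^d and leaves a
    determinant that is nonzero at 0: otherwise there would be u <> 0 with
    U(0) u = u and U(0) L u in ran (U(0) - 1), L being the diagonal matrix of
    lengths; pairing with u, which is also fixed by U(0)^*, yields u^* L u = 0,
    against L > 0. *)
Require Import Defs.
From HB Require Import structures.
From mathcomp Require Import all_boot all_order all_algebra ssrAC.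
From mathcomp Require Import complex.
From mathcomp Require Import all_classical all_reals all_analysis.
From mathcomp Require Import measurable_realfun ring lra zify.
Set Implicit Arguments.
Unset Strict Implicit.
Unset Printing Implicit Defensive.
Import Order.TTheory GRing.Theory Num.Theory.
Import numFieldNormedType.Exports.
Local Open Scope classical_set_scope.
Local Open Scope ring_scope.
Local Open Scope complex_scope.

(** * Square-integrable functions on an interval *)

Section RealIntegral.
Context (R : realType) (l : R).
Notation mu := (@lebesgue_measure R).
Notation D := (`[0%R, l]%classic : set R).
Implicit Types u v : R -> R.

(** Extension by zero, in the form used by [L2], so that [L2 f] unfolds to this condition on the
    real and imaginary parts over each edge. *)
Definition square_integrable u := u \* \1_D \in Lfun mu 2%:E.

Lemma square_integrable_continuous u :
  {within D, continuous u} -> square_integrable u.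
Proof.
move=> cu.
have mu1 : measurable_fun [set: R] (u \* \1_D).
  have -> : u \* \1_D = u \_ D.
    by apply/funext => x; rewrite /= patchE indicE; case: ifP => _; rewrite /= ?(mulr1, mulr0).
  apply/measurable_restrict => //; rewrite setIidr//.
  exact: subspace_continuous_measurable_fun.
have iu : mu.-integrable D (EFin \o (fun x => u x ^+ 2)).
  apply: continuous_compact_integrable; first exact: segment_compact.
  by move=> x; exact: (@continuousM R (subspace D) u u x (cu x) (cu x)).
rewrite /square_integrable; apply/andP; split; rewrite inE //= /finite_norm unlock /=.
apply: poweR_lty.
have mD : measurable (D : set (measurableTypeR R)) by exact: measurable_itv.
have /integrableP[_] := (integrable_mkcond _ mD).1 iu.
apply: le_lt_trans; rewrite le_eqVlt; apply/orP; left; apply/eqP.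
apply: eq_integral => x _; rewrite patchE indicE; case: ifP => _ /=.
  by rewrite mulr1 powR_mulrn// normrX.
by rewrite mulr0 normr0 powR0 // pnatr_eq0.
Qed.

Lemma square_integrable_cst c : square_integrable (cst c).
Proof. by apply: square_integrable_continuous => x; exact: cst_continuous. Qed.

Lemma square_integrableB u v : square_integrable u -> square_integrable v ->
  square_integrable (u \- v).
Proof.
rewrite /square_integrable => hu hv.
have -> : (u \- v) \* \1_D = u \* \1_D - v \* \1_D.
  by apply/funext => x; rewrite /= mulrBl.
have p1 : (1 <= 2%:E :> \bar R)%E by rewrite lee_fin ler1n.
by apply: (Lfun_addr_closed mu p1).2 => //; exact: Lfun_oppr_closed.
Qed.

Lemma square_integrable_measurable u :
  square_integrable u -> measurable_fun D u.
Proof.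
rewrite /square_integrable inE => /andP[+ _]; rewrite inE /= => m.
apply: (eq_measurable_fun (u \* \1_D)); last exact: measurable_funTS.
by move=> x xD; rewrite /= indicE xD mulr1.
Qed.

Lemma square_integrableM u v : square_integrable u -> square_integrable v ->
  mu.-integrable D (EFin \o (u \* v)).
Proof.
move=> hu hv; have mD : measurable (D : set (measurableTypeR R)) by exact: measurable_itv.
apply/(integrable_mkcond _ mD).
have /Lfun1_integrable := Lfun2_mul_Lfun1 hu hv.
congr (integrable _ _ _); apply/funext => x.
rewrite patchE /= indicE; case: ifP => _ /=; first by rewrite !mulr1.
by rewrite !mulr0.
Qed.

(** On a bounded interval the constant 1 is square integrable and serves as the second factor. *)
Lemma square_integrable_integrable u : square_integrable u ->
  mu.-integrable D (EFin \o u).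
Proof.
move=> hu; have := square_integrableM hu (square_integrable_cst 1).
by congr (integrable _ _ _); apply/funext => x /=; rewrite mulr1.
Qed.

(** The primitive of an integrable function is continuous, hence bounded on the segment; this puts
    antiderivatives of one-forms in [L2]. *)
Lemma square_integrable_prim u : 0 <= l -> square_integrable u ->
  square_integrable (fun x => Rintegral mu `[0, x]%classic u).
Proof.
move=> l0 hu; apply: square_integrable_continuous.
by apply: parameterized_integral_continuous => //; exact: square_integrable_integrable.
Qed.

Lemma Rintegral_itv_cst (c x : R) : 0 <= x -> Rintegral mu `[0, x]%classic (cst c) = c * x.
Proof.
move=> x0; rewrite /cst Rintegral_cst; last exact: measurable_itv.
congr (_ * _); transitivity (fine (mu `[0, x]%classic)); first by [].
rewrite lebesgue_measure_itv /= lte_fin sube0.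
case: ltP => // x0'.
by apply/eqP; rewrite eq_le x0 x0'.
Qed.

Lemma ae_eq_in_imp (T U : Type) (f g : R -> T) (f' g' : R -> U) :
  (forall x, D x -> f x = g x -> f' x = g' x) ->
  f = g %[ae mu in D] -> f' = g' %[ae mu in D].
Proof.
move=> h; apply: (@filterS _ _ (ae_filter_ringOfSetsType mu)) => x k Dx.
by apply: h => //; exact: k.
Qed.

Lemma ae_eq_in_imp2 (T U V : Type) (f g : R -> T) (f' g' : R -> U) (f'' g'' : R -> V) :
  (forall x, D x -> f x = g x -> f' x = g' x -> f'' x = g'' x) ->
  f = g %[ae mu in D] -> f' = g' %[ae mu in D] -> f'' = g'' %[ae mu in D].
Proof.
move=> h; apply: (@filterS2 _ _ (ae_filter_ringOfSetsType mu)) => x k k' Dx.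
by apply: h => //; [exact: k|exact: k'].
Qed.

Lemma ae_eq_Rintegral u v : measurable_fun D u -> measurable_fun D v ->
  u = v %[ae mu in D] -> Rintegral mu D u = Rintegral mu D v.
Proof.
move=> hu hv uv; congr fine; apply: ae_eq_integral => //.
- exact/measurable_EFinP.
- exact/measurable_EFinP.
- by apply: ae_eq_in_imp uv => x _ ->.
Qed.

End RealIntegral.

(** * Complex-valued integrals over an edge *)

Section ComplexIntegral.
Context (R : realType) (l : R).
Notation mu := (@lebesgue_measure R).
Notation D := (`[0%R, l]%classic : set R).
Notation Re := complex.Re.
Notation Im := complex.Im.
Implicit Types (f g h : R -> R[i]) (c : R[i]).

Definition csquare_integrable h :=
  square_integrable l (fun x => Re (h x)) /\ square_integrable l (fun x => Im (h x)).

Definition cintegrable h :=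
  mu.-integrable D (EFin \o (fun x => Re (h x))) /\
  mu.-integrable D (EFin \o (fun x => Im (h x))).

Lemma eq_complex_integral f g : {in D, f =1 g} ->
  complex_integral D f = complex_integral D g.
Proof.
by move=> fg; congr Complex; apply: eq_Rintegral => x xD; rewrite fg.
Qed.

Lemma csquare_integrable_cst c : csquare_integrable (cst c).
Proof. by split; exact: square_integrable_cst. Qed.

Lemma csquare_integrableB f g : csquare_integrable f -> csquare_integrable g ->
  csquare_integrable (fun x => f x - g x).
Proof.
move=> [fr fi] [gr gi]; split.
  have -> : (fun x => Re (f x - g x)) = (fun x => Re (f x)) \- (fun x => Re (g x)).
    by apply/funext => x /=; case: (f x) (g x) => ? ? [].
  exact: square_integrableB.
have -> : (fun x => Im (f x - g x)) = (fun x => Im (f x)) \- (fun x => Im (g x)).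
  by apply/funext => x /=; case: (f x) (g x) => ? ? [].
exact: square_integrableB.
Qed.

Lemma csquare_integrable_cintegrable f : csquare_integrable f -> cintegrable f.
Proof. by move=> [? ?]; split; exact: square_integrable_integrable. Qed.

Lemma csquare_integrable_prim c f : 0 <= l -> csquare_integrable f ->
  csquare_integrable (fun x => c + complex_integral `[0, x]%classic f).
Proof.
move=> l0 [fr fi].
have -> : (fun x => c + complex_integral `[0, x]%classic f) =
    (fun x => complex_integral `[0, x]%classic f - (- c)).
  by apply/funext => x; rewrite opprK addrC.
apply: (@csquare_integrableB (fun x => complex_integral `[0, x]%classic f) (cst (- c))).
  by split; exact: square_integrable_prim.
exact: csquare_integrable_cst.
Qed.

Let mD : measurable (D : set (measurableTypeR R)).
Proof. exact: measurable_itv. Qed.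

Lemma csquare_integrable_mulJ f g : csquare_integrable f -> csquare_integrable g ->
  cintegrable (fun x => f x * (g x)^*).
Proof.
move=> [fr fi] [gr gi]; split.
  have -> : EFin \o (fun x => Re (f x * (g x)^*)) =
     ((EFin \o (fun x => Re (f x) * Re (g x))%R) \+
     (EFin \o (fun x => Im (f x) * Im (g x))%R))%E.
    apply/funext => x /=; rewrite -EFinD; congr EFin.
    by case: (f x) (g x) => ? ? [] ? ? /=; rewrite mulrN opprK.
  by apply: integrableD => //; exact: square_integrableM.
have -> : EFin \o (fun x => Im (f x * (g x)^*)) =
   ((EFin \o (fun x => Im (f x) * Re (g x))%R) \-
   (EFin \o (fun x => Re (f x) * Im (g x))%R))%E.
  apply/funext => x /=; rewrite -EFinB; congr EFin.
  by case: (f x) (g x) => ? ? [] ? ? /=; rewrite mulrN addrC.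
by apply: integrableB => //; exact: square_integrableM.
Qed.

Lemma complex_integralB f g : cintegrable f -> cintegrable g ->
  complex_integral D (fun x => f x - g x) = complex_integral D f - complex_integral D g.
Proof.
move=> [fr fi] [gr gi]; rewrite /complex_integral /=.
transitivity ((Rintegral mu D (fun x => Re (f x)) - Rintegral mu D (fun x => Re (g x)))
  +i* (Rintegral mu D (fun x => Im (f x)) - Rintegral mu D (fun x => Im (g x)))) => //.
rewrite -!RintegralB//; congr Complex; apply: eq_Rintegral => x _;
  by case: (f x) (g x) => ? ? [].
Qed.

Lemma complex_integralZ f c : cintegrable f ->
  complex_integral D (fun x => f x * c) = complex_integral D f * c.
Proof.
move=> [fr fi]; rewrite /complex_integral /=; case: c => a b.
have ZR := fun u r (hu : mu.-integrable D (EFin \o u)) => RintegralZr r mD hu.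
have iZ u r : mu.-integrable D (EFin \o u) -> mu.-integrable D (EFin \o (fun x => u x * r)).
  move=> hu; have := integrableZr mD r hu.
  by congr (integrable _ _ _); apply/funext.
transitivity ((Rintegral mu D (fun x => Re (f x)) * a - Rintegral mu D (fun x => Im (f x)) * b)
  +i* (Rintegral mu D (fun x => Re (f x)) * b + Rintegral mu D (fun x => Im (f x)) * a)) => //.
rewrite -!ZR// -RintegralB//; [|exact: iZ..].
rewrite -RintegralD//; [|exact: iZ..].
by congr Complex; apply: eq_Rintegral => x _; case: (f x).
Qed.

Lemma ae_eq_complex_integral_mulJ f f' g g' :
  csquare_integrable f -> csquare_integrable f' ->
  csquare_integrable g -> csquare_integrable g' ->
  f = f' %[ae mu in D] -> g = g' %[ae mu in D] ->
  complex_integral D (fun x => f x * (g x)^*) =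
  complex_integral D (fun x => f' x * (g' x)^*).
Proof.
move=> hf hf' hg hg' ff' gg'.
have [ir ii] := csquare_integrable_mulJ hf hg.
have [ir' ii'] := csquare_integrable_mulJ hf' hg'.
congr Complex; apply: ae_eq_Rintegral;
  try by apply/measurable_EFinP; apply: (measurable_int mu).
  by apply: ae_eq_in_imp2 ff' gg' => x _ -> ->.
by apply: ae_eq_in_imp2 ff' gg' => x _ -> ->.
Qed.

Lemma complex_integral_mulJ_ge0 f : 0 <= complex_integral D (fun x => f x * (f x)^*).
Proof.
rewrite /complex_integral.
(* A number times its conjugate is real, so the imaginary integrand vanishes identically. *)
rewrite [X in _ +i* X](_ : _ = 0); last first.
  rewrite -[RHS](Rintegral_set0 mu (fun=> 0)) /Rintegral integral_set0.
  rewrite (eq_integral (cst 0%E)) ?integral0// => x _.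
  by case: (f x) => a b /=; rewrite mulrN mulrC addNr.
rewrite ler0c; apply: Rintegral_ge0 => x _; case: (f x) => a b /=.
by rewrite mulrN opprK addr_ge0// -expr2 sqr_ge0.
Qed.

Lemma complex_integral_mulJ_eq0 f : csquare_integrable f ->
  complex_integral D (fun x => f x * (f x)^*) = 0 -> f = (fun=> 0) %[ae mu in D].
Proof.
move=> hf; have [ir _] := csquare_integrable_mulJ hf hf.
move=> /(congr1 (@complex.Re _)) /= /eqP.
have nn x : 0 <= Re (f x * (f x)^*).
  by case: (f x) => a b /=; rewrite mulrN opprK addr_ge0// -expr2 sqr_ge0.
rewrite /Rintegral fine_eq0; last by apply: integrable_fin_num.
move=> /eqP i0.
have /ae_eq_integral_abs : (\int[mu]_(x in D) `|(Re (f x * (f x)^*)%R)%:E| = 0)%E.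
  by rewrite -[RHS]i0; apply: eq_integral => x _; rewrite /= ger0_norm.
move=> /(_ mD (measurable_int mu ir)).
apply: ae_eq_in_imp => x _ [] /eqP.
case: (f x) => a b /=; rewrite mulrN opprK -!expr2 paddr_eq0 ?sqr_ge0// !sqrf_eq0.
by move=> /andP[/eqP -> /eqP ->].
Qed.

(** Stated for every x <= l, so that the primitive of a null function vanishes at each point and not
    only at the far end. *)
Lemma ae_eq0_complex_integral f (x : R) : csquare_integrable f -> x <= l ->
  f = (fun=> 0) %[ae mu in D] -> complex_integral `[0, x]%classic f = 0.
Proof.
move=> [fr fi] xl f0.
have sub : `[0, x]%classic `<=` D.
  by move=> y /=; rewrite !in_itv /= => /andP[-> /le_trans]; apply.
have z u : square_integrable l u -> u = (fun=> 0) %[ae mu in D] ->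
    Rintegral mu `[0, x]%classic u = 0.
  move=> hu u0; rewrite (@ae_eq_Rintegral _ x u (fun=> 0)).
  - by rewrite /Rintegral integral0.
  - by apply: measurable_funS (square_integrable_measurable hu).
  - exact: measurable_cst.
  - by apply: (@filterS _ _ (ae_filter_ringOfSetsType mu)) u0 => y h /sub /h.
rewrite /complex_integral !z//.
- by apply: ae_eq_in_imp f0 => y _ ->.
- by apply: ae_eq_in_imp f0 => y _ ->.
Qed.

End ComplexIntegral.

Lemma complex_integral_cst (R : realType) (c : R[i]) (x : R) : 0 <= x ->
  complex_integral `[0, x]%classic (cst c) = c * x%:C.
Proof.
move=> x0; rewrite /complex_integral /=.
rewrite (Rintegral_itv_cst (complex.Re c))// (Rintegral_itv_cst (complex.Im c))//.
by case: c => a b /=; simpc.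
Qed.

Lemma complex_integral0 (R : realType) (A : set R) :
  complex_integral A (fun=> 0 : R[i]) = 0.
Proof. by rewrite /complex_integral /Rintegral /= integral0. Qed.

Lemma complex_integral_set1 (R : realType) (f : R -> R[i]) :
  complex_integral `[0, 0]%classic f = 0.
Proof. by rewrite /complex_integral set_itv1 !Rintegral_set1. Qed.

(** * The complex exponential *)

(** Raises the order of a bound by one through the mean value theorem. The factor 1/(n+1) is given
    up; only the order matters for the Taylor remainders. *)
Lemma MVT_power_bound (R : realType) (f f' : R -> R) (C : R) (n : nat) :
  0 <= C -> (forall x : R, is_derive x 1 f (f' x)) -> f 0 = 0 ->
  (forall x : R, `|x| <= 1 -> `|f' x| <= C * `|x| ^+ n) ->
  forall x : R, `|x| <= 1 -> `|f x| <= C * `|x| ^+ n.+1.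
Proof.
move=> C0 df f0 hf' x x1.
have cf : continuous f.
  by move=> y; apply/differentiable_continuous/derivable1_diffP; apply: ex_derive.
have key c : `|c| <= `|x| -> `|f x| = `|f' c| * `|x| -> `|f x| <= C * `|x| ^+ n.+1.
  move=> cx ->; rewrite exprSr mulrA ler_wpM2r//.
  apply: le_trans (hf' c (le_trans cx x1)) _.
  by rewrite ler_wpM2l// lerXn2r// nnegrE.
have [x0|x0|->] := ltgtP x 0; last by rewrite f0 !normr0 mulr_ge0.
- have [c cx] := @MVT R f f' x 0 x0 (fun y _ => df y) (continuous_subspaceT cf).
  rewrite f0 !sub0r => e; apply: (key c).
    move: cx; rewrite in_itv/= => /andP[xc c0].
    by rewrite !ltr0_norm// lerN2 ltW.
  by rewrite -[LHS]normrN e normrM normrN.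
- have [c cx] := @MVT R f f' 0 x x0 (fun y _ => df y) (continuous_subspaceT cf).
  rewrite f0 !subr0 => e; apply: (key c); last by rewrite e normrM.
  move: cx; rewrite in_itv/= => /andP[xc c0].
  by rewrite !gtr0_norm// ltW.
Qed.

(** * Taylor remainders of sine, cosine and the exponential on [-1, 1] *)

Section Taylor.
Variable R : realType.
Implicit Types x : R.

Lemma sin_bound1 x : `|x| <= 1 -> `|sin x| <= `|x|.
Proof.
move=> x1; rewrite -[X in _ <= X]mul1r -(expr1 `|x|).
apply: (@MVT_power_bound _ sin cos 1 0) => //; first exact: sin0.
by move=> y _; rewrite expr0 mulr1 cos_max.
Qed.

Lemma cos_bound2 x : `|x| <= 1 -> `|cos x - 1| <= `|x| ^+ 2.
Proof.
move=> x1; rewrite -[X in _ <= X]mul1r.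
apply: (@MVT_power_bound _ (fun x => cos x - 1) (fun x => - sin x) 1 1) => //.
- by move=> y; apply: is_derive_eq; rewrite subr0.
- by rewrite cos0 subrr.
- by move=> y y1; rewrite normrN mul1r expr1 sin_bound1.
Qed.

Lemma sin_bound3 x : `|x| <= 1 -> `|sin x - x| <= `|x| ^+ 3.
Proof.
move=> x1; rewrite -[X in _ <= X]mul1r.
apply: (@MVT_power_bound _ (fun x => sin x - x) (fun x => cos x - 1) 1 2) => //.
- by rewrite sin0 subrr.
- by move=> y y1; rewrite mul1r cos_bound2.
Qed.

Lemma cos_bound3 x : `|x| <= 1 -> `|cos x - 1 + x ^+ 2 / 2| <= `|x| ^+ 3.
Proof.
move=> x1; rewrite -[X in _ <= X]mul1r.
apply: (@MVT_power_bound _ (fun x => cos x - 1 + x ^+ 2 / 2)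
  (fun x => - sin x + x) 1 2) => //.
- move=> y; apply: is_derive_eq.
  by rewrite subr0 /GRing.scale /=; field.
- by rewrite cos0 subrr expr0n /= mul0r addr0.
- move=> y y1; rewrite addrC -normrN opprB mul1r.
  apply: le_trans (sin_bound3 y1) _.
  by rewrite [leLHS]exprS ler_piMl ?exprn_ge0.
Qed.

Lemma expR_bound0 x : `|x| <= 1 -> `|expR x| <= expR 1.
Proof.
move=> x1; rewrite ger0_norm ?expR_ge0//.
by rewrite ler_expR (le_trans (ler_norm _)).
Qed.

Lemma expR_bound1 x : `|x| <= 1 -> `|expR x - 1| <= expR 1 * `|x|.
Proof.
move=> x1; rewrite -(expr1 `|x|).
apply: (@MVT_power_bound _ (fun x => expR x - 1) expR (expR 1) 0) => //.
- by move=> y; apply: is_derive_eq; rewrite subr0.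
- by rewrite expR0 subrr.
- by move=> y y1; rewrite expr0 mulr1 expR_bound0.
Qed.

Lemma expR_bound2 x : `|x| <= 1 -> `|expR x - 1 - x| <= expR 1 * `|x| ^+ 2.
Proof.
move=> x1.
apply: (@MVT_power_bound _ (fun x => expR x - 1 - x) (fun x => expR x - 1) (expR 1) 1) => //.
- by move=> y; apply: is_derive_eq; rewrite subr0.
- by rewrite expR0 subrr subr0.
- by move=> y y1; rewrite expr1 expR_bound1.
Qed.

Lemma expR_bound3 x : `|x| <= 1 -> `|expR x - 1 - x - x ^+ 2 / 2| <= expR 1 * `|x| ^+ 3.
Proof.
move=> x1.
apply: (@MVT_power_bound _ (fun x => expR x - 1 - x - x ^+ 2 / 2)
  (fun x => expR x - 1 - x) (expR 1) 2) => //.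
- move=> y; apply: is_derive_eq.
  by rewrite subr0 /GRing.scale /=; field.
- by rewrite expR0 subrr expr0n /= mul0r !subr0.
- by move=> y y1; rewrite expR_bound2.
Qed.

End Taylor.

(** * Complex differentiability of the exponential and of its difference quotient *)

Section Cexp.
Variable R : realType.
Implicit Types (z w a c : R[i]).
Notation Re := complex.Re.
Notation Im := complex.Im.

Lemma normc_ge_Im z : `|Im z|%:C <= `|z|.
Proof.
have := normc_ge_Re (z * 'i%C); rewrite ReiNIm normrN => /le_trans; apply.
by rewrite normrM [X in _ * X]normc_def /= expr0n expr1n add0r sqrtr1 mulr1.
Qed.

Lemma normc_le_ReIm z : `|z| <= (`|Re z| + `|Im z|)%:C.
Proof.
have e (x : R) : `|x%:C| = `|x|%:C by rewrite normc_def /= expr0n addr0 sqrtr_sqr.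
rewrite [X in `|X|]complexE [leRHS](rmorphD (real_complex R)) /= -!e (le_trans (ler_normD _ _))// lerD2l.
by rewrite normrM [X in X * _]normc_def /= expr0n expr1n add0r sqrtr1 mul1r.
Qed.

Lemma cexpE z : cexp z = (expR (Re z) * cos (Im z)) +i* (expR (Re z) * sin (Im z)).
Proof. by rewrite /cexp; simpc. Qed.

Lemma cexpD z w : cexp (z + w) = cexp z * cexp w.
Proof.
rewrite !cexpE; case: z w => a b [c d] /=.
rewrite expRD cosD sinD; apply/eqP; rewrite eq_complex /=.
by apply/andP; split; apply/eqP; ring.
Qed.

Lemma cexp0 : cexp 0 = 1 :> R[i].
Proof. by rewrite cexpE /= expR0 cos0 sin0 mul1r mulr0. Qed.

(** A third-order remainder is required because the quotient (exp(ck) - 1)/k must itself be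
    differentiable at 0. *)
Lemma cexp_taylor2 : exists2 C : R[i], 0 <= C & forall z, `|z| <= 1 ->
  `|cexp z - 1 - z - z ^+ 2 / 2| <= C * `|z| ^+ 3.
Proof.
(* The real part splits into three errors and the imaginary part into two, each at most e |z|^3. *)
exists (5 * expR 1)%:C; first by rewrite ler0c mulr_ge0// expR_ge0.
move=> z z1; have [r rE] : exists r : R, `|z| = r%:C.
  by rewrite normc_def; eexists.
have := normc_ge_Re z; have := normc_ge_Im z.
move: z1; rewrite rE -[1]/(1%:C) !lecR => r1 yr xr.
rewrite -rmorphXn -rmorphM /=; apply: (le_trans (normc_le_ReIm _)); rewrite lecR.
set K := expR 1; have K0 : 0 <= K by exact: expR_ge0.
have r0 : 0 <= r by rewrite (le_trans _ xr).
case: z rE xr yr => x y _ xr yr; rewrite /= in xr yr.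
have x1 : `|x| <= 1 by exact: le_trans xr r1.
have y1 : `|y| <= 1 by exact: le_trans yr r1.
(* Grouped so that every summand is a product of one-variable remainders and powers of total order
   3; likewise for the imaginary part. *)
have re : Re (cexp (x +i* y) - 1 - (x +i* y) - (x +i* y) ^+ 2 / 2) =
  (expR x - 1 - x - x ^+ 2 / 2) + expR x * (cos y - 1 + y ^+ 2 / 2)
  - (expR x - 1) * (y ^+ 2 / 2).
  have -> : (2 : R[i])^-1 = (2^-1)%:C by rewrite fmorphV rmorph_nat.
  by rewrite cexpE expr2 /=; field.
have im : Im (cexp (x +i* y) - 1 - (x +i* y) - (x +i* y) ^+ 2 / 2) =
  expR x * (sin y - y) + (expR x - 1 - x) * y.
  have -> : (2 : R[i])^-1 = (2^-1)%:C by rewrite fmorphV rmorph_nat.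
  by rewrite cexpE expr2 /=; field.
have pw n : `|x| ^+ n <= r ^+ n /\ `|y| ^+ n <= r ^+ n.
  by split; rewrite lerXn2r// nnegrE.
have [[xr2 yr2] [xr3 yr3]] := (pw 2%N, pw 3%N).
have b1 : `|expR x - 1 - x - x ^+ 2 / 2| <= K * r ^+ 3.
  by apply: le_trans (expR_bound3 x1) _; rewrite ler_wpM2l.
have b2 : `|expR x * (cos y - 1 + y ^+ 2 / 2)| <= K * r ^+ 3.
  by rewrite normrM ler_pM// ?expR_bound0// (le_trans (cos_bound3 y1)).
have b3 : `|(expR x - 1) * (y ^+ 2 / 2)| <= K * r ^+ 3.
  have -> : K * r ^+ 3 = (K * r) * r ^+ 2 by ring.
  rewrite normrM ler_pM//.
    by rewrite (le_trans (expR_bound1 x1))// ler_wpM2l.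
  rewrite normrM normrX (le_trans _ yr2)// ler_piMr// ger0_norm//; lra.
have b4 : `|expR x * (sin y - y)| <= K * r ^+ 3.
  by rewrite normrM ler_pM// ?expR_bound0// (le_trans (sin_bound3 y1)).
have b5 : `|(expR x - 1 - x) * y| <= K * r ^+ 3.
  have -> : K * r ^+ 3 = (K * r ^+ 2) * r by ring.
  rewrite normrM ler_pM//.
  by rewrite (le_trans (expR_bound2 x1))// ler_wpM2l.
rewrite re im; apply: (le_trans (lerD (ler_normB _ _) (ler_normD _ _))).
apply: (le_trans (lerD (lerD (ler_normD _ _) b3) (lerD b4 b5))).
by apply: (le_trans (lerD (lerD (lerD b1 b2) (lexx _)) (lexx _))); lra.
Qed.

Lemma cexp_taylor1 : exists2 C : R[i], 0 <= C & forall z, `|z| <= 1 ->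
  `|cexp z - 1 - z| <= C * `|z| ^+ 2.
Proof.
have [C C0 hC] := cexp_taylor2.
exists (C + 2^-1); first by rewrite addr_ge0 // invr_ge0.
move=> z z1.
have -> : cexp z - 1 - z = (cexp z - 1 - z - z ^+ 2 / 2) + z ^+ 2 / 2 by rewrite subrK.
apply: (le_trans (ler_normD _ _)); rewrite mulrDl lerD//.
  apply: le_trans (hC z z1) _; rewrite ler_wpM2l// exprS ler_piMl ?exprn_ge0//.
by rewrite normrM normrX mulrC normfV normr_nat.
Qed.

(** The difference quotient at h differs from d by at most C |h|, which tends to 0. *)
Lemma derivable_quadratic (f : R[i]^o -> R[i]^o) a (d C e : R[i]) :
  0 <= C -> 0 < e ->
  (forall h, `|h| <= e -> `|f (h + a) - f a - d * h| <= C * `|h| ^+ 2) ->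
  derivable f a 1.
Proof.
move=> C0 e0 hf; apply/cvg_ex; exists d; apply/cvgrPdist_le => /= eps eps0.
near=> h.
have h0 : h != 0 by near: h; exists 1 => /=.
have he : `|h| <= e by near: h; exact: (@dnbhs0_le _ (R[i]^o) _ e0).
(* C + 1 keeps the denominator positive when C = 0. *)
have hC : `|h| <= eps / (C + 1).
  by near: h; apply: (@dnbhs0_le _ (R[i]^o)); rewrite divr_gt0// ltr_wpDl.
have -> : d - h^-1 *: ((f \o shift a) (h *: 1) - f a) =
    - (h^-1 * (f (h + a) - f a - d * h)).
  rewrite [h *: 1]mulr1 /=; change (d - h^-1 * (f (h + a) - f a) =
    - (h^-1 * (f (h + a) - f a - d * h))).
  by field.
rewrite normrN normrM normfV mulrC ler_pdivrMr ?normr_gt0//.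
apply: (le_trans (hf h he)); rewrite expr2 mulrA ler_wpM2r//.
apply: (@le_trans _ _ ((C + 1) * `|h|)); first by rewrite ler_wpM2r// lerDl.
by rewrite mulrC -ler_pdivlMr// ltr_wpDl.
Unshelve. all: by end_near. Qed.

(** The entire function (exp(ck) - 1)/k, its removable singularity filled with c. It allows k to be
    factored out of U(k) - U(0). *)
Definition cexp_diff c : R[i]^o -> R[i]^o :=
  fun k => if k == 0 then c else (cexp (c * k) - 1) / k.

Lemma cexp_diffE c k : cexp (c * k) = 1 + k * cexp_diff c k.
Proof.
rewrite /cexp_diff; case: eqP => [->|/eqP k0]; first by rewrite mulr0 mul0r addr0 cexp0.
by rewrite [k * _]mulrC divfK// addrC subrK.
Qed.

Lemma derivable_cexpZ c (a : R[i]^o) : derivable (fun k : R[i]^o => cexp (c * k) : R[i]^o) a 1.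
Proof.
have [C C0 hC] := cexp_taylor1.
(* The radius 1/(|c| + 1) forces |ch| <= 1, where the Taylor bound holds, and makes sense for c =
   0. *)
apply: (@derivable_quadratic _ _ (cexp (c * a) * c) (`|cexp (c * a)| * (C * `|c| ^+ 2)) (`|c| + 1)^-1).
- by rewrite !mulr_ge0 ?exprn_ge0.
- by rewrite invr_gt0 ltr_wpDl.
move=> h hb; have ch1 : `|c * h| <= 1.
  rewrite normrM (le_trans (ler_wpM2l _ hb))// ler_pdivrMr ?ltr_wpDl// mul1r lerDl//.
rewrite mulrDr cexpD.
have -> : cexp (c * h) * cexp (c * a) - cexp (c * a) - cexp (c * a) * c * h =
   cexp (c * a) * (cexp (c * h) - 1 - c * h) by ring.
by rewrite normrM -mulrA ler_wpM2l// -mulrA -exprMn -normrM hC.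
Qed.

Lemma derivable_cexp_diff c (a : R[i]^o) : derivable (cexp_diff c) a 1.
Proof.
have [->|a0] := eqVneq a 0.
  have [C C0 hC] := cexp_taylor2.
  (* The derivative at 0 is the next Taylor coefficient: exp(ch) = 1 + ch + (ch)^2/2 + O(h^3),
     divided by h. *)
  apply: (@derivable_quadratic _ _ (c ^+ 2 / 2) (C * `|c| ^+ 3) (`|c| + 1)^-1).
  - by rewrite !mulr_ge0 ?exprn_ge0.
  - by rewrite invr_gt0 ltr_wpDl.
  move=> h hb; have ch1 : `|c * h| <= 1.
    rewrite normrM (le_trans (ler_wpM2l _ hb))// ler_pdivrMr ?ltr_wpDl// mul1r lerDl//.
  rewrite addr0 /cexp_diff eqxx; case: eqP => [->|/eqP h0].
    by rewrite subrr mulr0 subr0 normr0 expr0n mulr0.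
  have -> : (cexp (c * h) - 1) / h - c - c ^+ 2 / 2 * h =
      (cexp (c * h) - 1 - c * h - (c * h) ^+ 2 / 2) / h by field.
  rewrite normrM normfV ler_pdivrMr ?normr_gt0//.
  have -> : C * `|c| ^+ 3 * `|h| ^+ 2 * `|h| = C * `|c * h| ^+ 3 by rewrite normrM; ring.
  exact: hC.
(* Near a nonzero point only the quotient branch is seen, and the usual rules apply. *)
have near_a : {near a, (fun k : R[i]^o => (cexp (c * k) - 1) / k : R[i]^o) =1 cexp_diff c}.
  near=> k; have k0 : k != 0.
    near: k; exists `|a|; first by rewrite /= normr_gt0.
    by move=> y /=; apply: contraTneq => ->; rewrite subr0 ltxx.
  by rewrite /cexp_diff (negbTE k0).
apply: near_eq_derivable near_a _.
have -> : (fun k : R[i]^o => (cexp (c * k) - 1) / k : R[i]^o) =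
    ((fun k : R[i]^o => cexp (c * k) : R[i]^o) - cst (1 : R[i]^o)) *
    (fun k : R[i]^o => (k : R[i])^-1 : R[i]^o).
  by apply/funext.
have dV : derivable (fun k : R[i]^o => (k : R[i])^-1 : R[i]^o) a 1.
  by apply: (@derivableV R[i] R[i]^o id) => //; exact: derivable_id.
apply: derivableM; last exact: dV.
by apply: derivableB; [exact: derivable_cexpZ|exact: derivable_cst].
Unshelve. all: by end_near. Qed.
End Cexp.

(** * Order of vanishing of the secular determinant *)

Section DerivableDet.
Variable R : realType.
Notation C := (R[i]^o).

Lemma derivable_bigsum (I : Type) (r : seq I) (P : pred I) (F : I -> C -> C) (a : C) :
  (forall i, derivable (F i) a 1) -> derivable (fun k => \sum_(i <- r | P i) F i k : C) a 1.
Proof.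
move=> dF; elim: r => [|i r IH].
  have -> : (fun k => \sum_(i <- [::] | P i) F i k : C) = cst 0.
    by apply/funext => k; rewrite big_nil.
  exact: derivable_cst.
case Pi: (P i).
  have -> : (fun k => \sum_(i <- i :: r | P i) F i k : C) =
      F i + (fun k => \sum_(i <- r | P i) F i k : C).
    by apply/funext => k; rewrite big_cons Pi.
  by apply: derivableD; [exact: dF|exact: IH].
have -> // : (fun k => \sum_(i <- i :: r | P i) F i k : C) =
    (fun k => \sum_(i <- r | P i) F i k : C).
by apply/funext => k; rewrite big_cons Pi.
Qed.

Lemma derivable_bigprod (I : Type) (r : seq I) (P : pred I) (F : I -> C -> C) (a : C) :
  (forall i, derivable (F i) a 1) -> derivable (fun k => \prod_(i <- r | P i) F i k : C) a 1.
Proof.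
move=> dF; elim: r => [|i r IH].
  have -> : (fun k => \prod_(i <- [::] | P i) F i k : C) = cst 1.
    by apply/funext => k; rewrite big_nil.
  exact: derivable_cst.
case Pi: (P i).
  have -> : (fun k => \prod_(i <- i :: r | P i) F i k : C) =
      F i * (fun k => \prod_(i <- r | P i) F i k : C).
    by apply/funext => k; rewrite big_cons Pi.
  by apply: derivableM; [exact: dF|exact: IH].
have -> // : (fun k => \prod_(i <- i :: r | P i) F i k : C) =
    (fun k => \prod_(i <- r | P i) F i k : C).
by apply/funext => k; rewrite big_cons Pi.
Qed.

Lemma derivable_scalel (c : R[i]) (f : C -> C) (a : C) :
  derivable f a 1 -> derivable (fun k => c * f k : C) a 1.
Proof.
move=> df; have dc : derivable (cst (c : C) : C -> C) a 1 by exact: derivable_cst.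
exact: (derivableM dc df).
Qed.

(** The Leibniz formula writes the determinant as a finite sum of products of entries. *)
Lemma derivable_det n (M : C -> 'M[R[i]]_n) (a : C) :
  (forall i j, derivable (fun k => M k i j : C) a 1) ->
  derivable (fun k => \det (M k) : C) a 1.
Proof.
move=> dM; apply: derivable_bigsum => s; apply: derivable_scalel.
by apply: derivable_bigprod => i.
Qed.

End DerivableDet.

(** * Extraction of the exact power of k from det (U(k) - 1) *)

Section VanishingOrder.
Variables (R : realType) (n : nat) (U : 'M[R[i]]_n) (L : 'I_n -> R).
Hypothesis unitaryU : U *m (U ^t*)%sesqui = 1%:M.
Hypothesis L_gt0 : forall j, 0 < L j.

(** Pairing the second equation with u^* cancels its right side, since u^* is also fixed by U, and
    leaves the sum of L_j |u_j|^2 equal to 0. *)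
Lemma fixed_weight_eq0 (u w : 'cV[R[i]]_n) :
  U *m u = u -> U *m diag_mx (\row_j (L j)%:C) *m u = (U - 1%:M) *m w -> u = 0.
Proof.
move=> Uu e.
have uU : ((u ^t*) *m U = u ^t*)%sesqui.
  have UtU : ((U ^t*) *m U = 1%:M)%sesqui by apply: mulmx1C.
  have : ((u ^t*) *m (U ^t*) = u ^t*)%sesqui by rewrite -[RHS]/((u ^t*)%sesqui) -{2}Uu trmx_mul map_mxM.
  by move=> {1}<-; rewrite -mulmxA UtU mulmx1.
have : ((u ^t*)%sesqui *m diag_mx (\row_j (L j)%:C) *m u) 0 0 = 0.
  rewrite -{1}uU -!mulmxA [U *m (_ *m _)]mulmxA e mulmxBl mul1mx mulmxBr.
  by rewrite mulmxA uU subrr mxE.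
rewrite mul_mx_diag mxE => /eqP.
rewrite psumr_eq0 => [/allP h|j _]; last first.
  rewrite !mxE -mulrA mulrCA mulr_ge0 ?ler0c ?(ltW (L_gt0 _))//.
  by rewrite mulrC mulcJ_ge0.
apply/colP => j; have := h j (mem_index_enum _).
rewrite !mxE /= -mulrA mulrCA mulf_eq0 => /orP[|].
  by rewrite -[0]/(0%:C) (inj_eq (@complexI _)) gt_eqF.
by rewrite mulf_eq0 conjC_eq0 orbb => /eqP.
Qed.

(** Transports [fixed_weight_eq0] through the rank factorization of U - 1. With u = Rr^-1 v, the
    vanishing of the first r entries of v says that U fixes u, and the vanishing of the others in X
    v says that U L u lies in the range of U - 1. *)
Lemma pid_kernel_eq0 (Lc Rr X : 'M[R[i]]_n) (r : nat) (v : 'cV[R[i]]_n) :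
  Lc \in unitmx -> Rr \in unitmx -> U - 1%:M = Lc *m pid_mx r *m Rr ->
  (pid_mx r : 'M[R[i]]_n) *m v = 0 ->
  X = invmx Lc *m (U *m diag_mx (\row_j ('i%C * (L j)%:C))) *m invmx Rr ->
  X *m v = pid_mx r *m (X *m v) -> v = 0.
Proof.
move=> Lu Ru AE pv XE Xv; pose u := invmx Rr *m v.
have vE : v = Rr *m u by rewrite mulKVmx.
have Uu : U *m u = u.
  apply/eqP; rewrite -subr_eq0 -{2}[u]mul1mx -mulmxBl AE -!mulmxA -vE pv.
  by rewrite mulmx0.
suff u0 : u = 0 by rewrite vE u0 mulmx0.
(* Rr^-1 X v is a preimage of U (iL) u under U - 1; the factor -i turns iL into L. *)
apply: (@fixed_weight_eq0 u (- 'i%C *: (invmx Rr *m (X *m v))) Uu).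
have -> : diag_mx (\row_j (L j)%:C) = - 'i%C *: diag_mx (\row_j ('i%C * (L j)%:C)).
  apply/matrixP => a b; rewrite !mxE mulrnAr mulrA mulNr -expr2 sqr_i opprK.
  by rewrite mul1r.
rewrite -!scalemxAr -scalemxAl; congr (_ *: _).
have -> : (U - 1%:M) *m (invmx Rr *m (X *m v)) = Lc *m (X *m v).
  by rewrite AE -!mulmxA (mulKVmx Ru) -Xv.
by rewrite XE -!mulmxA (mulKVmx Lu).
Qed.

Lemma ebase_factor (A Lc Rr X M : 'M[R[i]]_n) (r : nat) (k : R[i]) :
  Lc \in unitmx -> Rr \in unitmx -> A = Lc *m pid_mx r *m Rr ->
  X = invmx Lc *m M *m invmx Rr ->
  A + k *: M = Lc *m (pid_mx r + k *: X) *m Rr.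
Proof.
move=> Lu Ru -> ->; rewrite mulmxDr mulmxDl; congr (_ + _).
by rewrite -scalemxAr -scalemxAl !mulmxA mulmxV// mul1mx -mulmxA mulVmx// mulmx1.
Qed.

(** After the base changes U(k) - 1 becomes [pid_mx r] + k X(k), whose last n - r rows are divisible
    by k. The remaining determinant is differentiable, and [pid_kernel_eq0] makes it nonzero at
    0. *)
Lemma vanishing_order0_det :
  vanishing_order0 (fun k => \det (U *m diag_mx (\row_j cexp ('i%C * k * (L j)%:C)) - 1%:M))
    (n - \rank (U - 1%:M)).
Proof.
set A := U - 1%:M; set r := \rank A.
pose E (k : R[i]^o) : 'M[R[i]]_n := diag_mx (\row_j cexp_diff ('i%C * (L j)%:C) k).
pose X (k : R[i]^o) := invmx (col_ebase A) *m (U *m E k) *m invmx (row_ebase A).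
(* After elimination, k divides the rows of index >= r; Y k is the quotient. *)
pose Y (k : R[i]^o) : 'M[R[i]]_n := \matrix_(i, j)
  if (i < r)%N then (i == j)%:R + k * X k i j else X k i j.
have Lu := col_ebase_unit A; have Ru := row_ebase_unit A.
exists (fun k => \det (col_ebase A) * \det (row_ebase A) * \det (Y k)); split.
- near=> a.
  apply: (@derivable_scalel _ (\det (col_ebase A) * \det (row_ebase A)) (fun k => \det (Y k))).
  apply: (@derivable_det _ _ Y) => i j.
  have dX : derivable (fun k : R[i]^o => X k i j : R[i]^o) a 1.
    have -> : (fun k : R[i]^o => X k i j : R[i]^o) = fun k => \sum_l
        ((invmx (col_ebase A) *m U) i l * invmx (row_ebase A) l j) *
        cexp_diff ('i%C * (L l)%:C) k.
      apply/funext => k; rewrite /X mulmxA mul_mx_diag mxE.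
      by apply: eq_bigr => l _; rewrite !mxE mulrAC.
    apply: derivable_bigsum => l; apply: derivable_scalel.
    exact: derivable_cexp_diff.
  have [ir|ir] := boolP (i < r)%N.
    have -> : (fun k => Y k i j : R[i]^o) =
        cst ((i == j)%:R : R[i]^o) + (@id (R[i]^o)) * (fun k => X k i j : R[i]^o).
      by apply/funext => k; rewrite mxE ir.
    apply: derivableD; first exact: derivable_cst.
    by apply: derivableM; [exact: derivable_id|exact: dX].
  suff -> : (fun k => Y k i j : R[i]^o) = (fun k => X k i j : R[i]^o) by [].
  by apply/funext => k; rewrite mxE (negbTE ir).
- rewrite !mulf_neq0//; try by rewrite -unitfE -unitmxE.
  (* Invertibility of [Y 0] is tested on an arbitrary column vector that it kills, obtained as a row
     of the kernel of its transpose. *)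
  rewrite -unitfE -unitmxE -unitmx_tr -row_free_unit -kermx_eq0.
  apply/eqP/row_matrixP => i; rewrite row0.
  have : row i (kermx (Y 0)^T) *m (Y 0)^T = 0 by rewrite -row_mul mulmx_ker row0.
  set v := row i _ => /(congr1 trmx); rewrite trmx_mul trmxK trmx0 => Yv; clearbody v.
  (* At k = 0 the first r rows of [Y 0] are rows of the identity, so the first r entries of v
     vanish. *)
  have pv : (pid_mx r : 'M[R[i]]_n) *m v^T = 0.
    apply/colP => j; have := congr1 (fun M : 'cV_n => M j 0) Yv; rewrite !mxE.
    have [jr|jr] := boolP (j < r)%N => e.
      rewrite -[RHS]e; apply: eq_bigr => l _; rewrite !mxE jr mul0r addr0.
      by rewrite andbT.
    by apply: big1 => l _; rewrite !mxE (negbTE jr) andbF mul0r.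
  (* The other rows of [Y 0] are those of [X 0], so [X 0 *m v^T] is supported on the first r
     entries. *)
  have Xv : X 0 *m v^T = pid_mx r *m (X 0 *m v^T).
    apply/colP => j; rewrite [in RHS]mxE.
    have [jr|jr] := boolP (j < r)%N.
      rewrite (bigD1 j)//= big1 ?addr0 => [|l lj].
        by rewrite [pid_mx _ _ _]mxE eqxx jr mul1r.
      by rewrite [pid_mx _ _ _]mxE eq_sym -val_eqE in lj *; rewrite (negbTE lj) mul0r.
    rewrite big1 => [|l _]; last by rewrite [pid_mx _ _ _]mxE (negbTE jr) andbF mul0r.
    transitivity ((Y 0 *m v^T) j 0); last by rewrite Yv mxE.
    by rewrite [LHS]mxE [RHS]mxE; apply: eq_bigr => l _; rewrite [Y 0 _ _]mxE (negbTE jr).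
  have E0 : E 0 = diag_mx (\row_j ('i%C * (L j)%:C)).
    by apply/matrixP => a b; rewrite !mxE /cexp_diff eqxx.
  apply: trmx_inj; rewrite trmx0.
  apply: (@pid_kernel_eq0 (col_ebase A) (row_ebase A) (X 0) r v^T Lu Ru _ pv _ Xv).
    by rewrite mulmx_ebase.
  by rewrite -E0.
- near=> k.
  have dE : diag_mx (\row_j cexp ('i%C * k * (L j)%:C)) = 1%:M + k *: E k.
    apply/matrixP => a b; rewrite !mxE mulrAC cexp_diffE.
    by case: eqP => _; rewrite ?mulr1n ?mulr0n ?mulr0 ?addr0.
  have YE : diag_mx (\row_(j < n) if (j < r)%N then 1 else k) *m Y k =
      pid_mx r + k *: X k.
    apply/matrixP => i j; rewrite mul_diag_mx !mxE.
    by case: ifP => ir; rewrite ?mul1r ?andbT ?andbF ?add0r.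
  have dk : \det (diag_mx (\row_(j < n) if (j < r)%N then 1 else k)) = k ^+ (n - r).
    rewrite det_diag; under eq_bigr do rewrite mxE.
    rewrite -(big_mkord xpredT (fun j => if (j < r)%N then 1 else k)).
    rewrite (big_cat_nat (leq0n r) (rank_leq_row A)) /=.
    rewrite big_nat_cond big1 => [|j /andP[/andP[_ ->]] //].
    rewrite mul1r -prodr_const_nat !big_nat; apply: eq_bigr => j /andP[rj _].
    by rewrite ltnNge rj.
  have -> : U *m diag_mx (\row_j cexp ('i%C * k * (L j)%:C)) - 1%:M =
      col_ebase A *m (diag_mx (\row_(j < n) if (j < r)%N then 1 else k) *m Y k) *m row_ebase A.
    rewrite YE -(@ebase_factor A _ _ (X k) (U *m E k) r k Lu Ru) ?mulmx_ebase//.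
    by rewrite dE mulmxDr mulmx1 -scalemxAr addrAC.
  have aux (a p y b : R[i]) : a * (p * y) * b = p * (a * b * y).
    ring.
  by rewrite !det_mulmx dk aux.
Unshelve. all: by end_near. Qed.

End VanishingOrder.

(** * A pair of reflections *)

Section ReflectionPair.
Variables (C : numClosedFieldType) (e n : nat) (I0 I1 : 'M[C]_(e, n)) (Pi : 'M[C]_n).
Hypothesis I00 : I0 *m I0^T = 1%:M.
Hypothesis I11 : I1 *m I1^T = 1%:M.
Hypothesis I01 : I0 *m I1^T = 0.
Hypothesis Isum : I0^T *m I0 + I1^T *m I1 = 1%:M.
Hypothesis I0_real : map_mx Num.conj I0 = I0.
Hypothesis I1_real : map_mx Num.conj I1 = I1.
Hypothesis Pi_idem : Pi *m Pi = Pi.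
Hypothesis Pi_herm : (Pi ^t*)%sesqui = Pi.

(** Vectors are rows and matrices act on the right. [I0] and [I1] place a vector indexed by edges on
    the two families of edge ends, so the row spaces of [Sy] and [As] are the symmetric and
    antisymmetric boundary vectors. *)
Let Sy := I0 + I1.
Let As := I1 - I0.
Let J := I0^T *m I1 + I1^T *m I0.

Let I10 : I1 *m I0^T = 0.
Proof. by apply: trmx_inj; rewrite trmx_mul trmxK I01 trmx0. Qed.

Let SyJ : Sy *m J = Sy.
Proof.
rewrite /Sy /J mulmxDl !mulmxDr !mulmxA I00 I01 I10 I11.
by rewrite !mul1mx !mul0mx addr0 add0r addrC.
Qed.

Let AsJ : As *m J = - As.
Proof.
rewrite /As /J mulmxBl !mulmxDr !mulmxA I00 I01 I10 I11.
by rewrite !mul1mx !mul0mx addr0 add0r opprB.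
Qed.

Let SySy : Sy^T *m Sy = 1%:M + J.
Proof.
by rewrite /Sy /J [X in X *m _]raddfD mulmxDl !mulmxDr -Isum (AC (2*2) ((1*4)*(2*3))).
Qed.

Let AsAs : As^T *m As = 1%:M - J.
Proof.
rewrite /As /J [X in X *m _]raddfB mulmxBl !mulmxBr -Isum opprB [in RHS]opprD.
by rewrite (AC (2*2) ((3*1)*(4*2))).
Qed.

Let SyT : Sy *m Sy^T = 2%:M.
Proof.
rewrite /Sy [X in _ *m X]raddfD mulmxDl !mulmxDr I00 I01 I10 I11 addr0 add0r.
by rewrite -raddfD.
Qed.

Let AsT : As *m As^T = 2%:M.
Proof.
rewrite /As [X in _ *m X]raddfB mulmxBl !mulmxBr I00 I01 I10 I11 subr0 sub0r opprK.
by rewrite -raddfD.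
Qed.

Let SyAs : Sy *m As^T = 0.
Proof.
rewrite /Sy /As [X in _ *m X]raddfB mulmxDl !mulmxBr I00 I01 I10 I11 subr0 sub0r.
by rewrite addNr.
Qed.

Let two_unit : 2%:M \in @unitmx C e.
Proof. by rewrite unitmxE det_scalar unitfE expf_neq0. Qed.

Let Sy_free : row_free Sy.
Proof.
apply/row_freeP; exists (Sy^T *m invmx 2%:M).
by rewrite mulmxA SyT mulmxV.
Qed.

Let As_free : row_free As.
Proof.
apply/row_freeP; exists (As^T *m invmx 2%:M).
by rewrite mulmxA AsT mulmxV.
Qed.

Let SyTN0 m (v : 'M[C]_(m, n)) : v *m Sy^T = 0 -> v *m J = - v.
Proof.
by move=> h; apply/eqP; rewrite -addr_eq0 addrC -{1}[v]mulmx1 -mulmxDr -SySy mulmxA h mul0mx.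
Qed.

Let half2 m k (X : 'M[C]_(m, k)) : X = 2^-1 *: (X + X).
Proof. by rewrite -mulr2n -[X *+ 2]scaler_nat scalerA mulVf ?scale1r// pnatr_eq0. Qed.

(** A row orthogonal to [Sy] is negated by [J], hence is half its image under As^T As = 1 - J. *)
Let ker_SyT : (kermx Sy^T :=: As)%MS.
Proof.
apply/eqmxP/andP; split.
  have h : kermx Sy^T *m J = - kermx Sy^T by apply: SyTN0; exact: mulmx_ker.
  rewrite [X in (X <= _)%MS](_ : _ = 2^-1 *: (kermx Sy^T *m As^T) *m As) ?submxMl//.
  rewrite -scalemxAl -mulmxA AsAs mulmxBr mulmx1 h opprK; exact: half2.
apply/sub_kermxP; apply: trmx_inj; rewrite trmx_mul trmxK trmx0.
exact: SyAs.
Qed.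

Let ker_PiC : (kermx (1%:M - Pi) :=: Pi)%MS.
Proof.
apply/eqmxP/andP; split.
  have := mulmx_ker (1%:M - Pi); rewrite mulmxBr mulmx1 => /eqP.
  by rewrite subr_eq0 => /eqP {1}->; exact: submxMl.
by apply/sub_kermxP; rewrite mulmxBr mulmx1 Pi_idem subrr.
Qed.

Let rank_trC m k (X : 'M[C]_(m, k)) : \rank ((X ^t*)%sesqui) = \rank X.
Proof. by rewrite mxrank_map mxrank_tr. Qed.

(** Conjugate transposition preserves rank; [Sy] is real and [Pi] Hermitian. *)
Let rank_SyPi : \rank (Sy *m Pi) = \rank (Pi *m Sy^T).
Proof.
rewrite -rank_trC trmx_mul map_mxM Pi_herm; congr (\rank (_ *m _)).
by rewrite -map_trmx /Sy map_mxD I0_real I1_real.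
Qed.

Let rank_capPiAs : \rank (Pi :&: As) = \rank (kermx (As *m (1%:M - Pi))).
Proof.
have := mxrank_mul_ker As (1%:M - Pi).
rewrite (cap_eqmx (eqmx_refl As) ker_PiC) capmxC (eqP As_free) => h.
by rewrite mxrank_ker; move: h; set a := \rank _; set b := \rank _ => <-; rewrite addKn.
Qed.

(** Rank-nullity for [Sy^T] restricted to the range of [Pi]: what it kills there is the intersection
    with [As]. *)
Lemma rank_Pi_eq :
  (\rank (Sy *m Pi) + \rank (kermx (As *m (1%:M - Pi))))%N = \rank Pi.
Proof.
rewrite rank_SyPi -rank_capPiAs -[RHS](mxrank_mul_ker Pi Sy^T).
by rewrite (cap_eqmx (eqmx_refl Pi) ker_SyT).
Qed.

Lemma rank_ker_index :
  (\rank (kermx (Sy *m Pi)) + \rank Pi = e + \rank (kermx (As *m (1%:M - Pi))))%N.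
Proof. by rewrite -rank_Pi_eq mxrank_ker addnA subnK// rank_leq_row. Qed.

Lemma fixed_space_rank :
  \rank (kermx ((1%:M - Pi *+ 2) *m J - 1%:M)) =
  (\rank (kermx (Sy *m Pi)) + \rank (kermx (As *m (1%:M - Pi))))%N.
Proof.
set K0 := kermx (Sy *m Pi); set K1 := kermx (As *m (1%:M - Pi)).
have K0e : K0 *m Sy *m Pi = 0 by rewrite -mulmxA mulmx_ker.
have K1e : K1 *m As *m Pi = K1 *m As.
  have := mulmx_ker (As *m (1%:M - Pi)); rewrite mulmxA mulmxBr mulmx1 => /eqP.
  by rewrite subr_eq0 => /eqP <-.
have mulB2 m (v : 'M[C]_(m, n)) : v *m (1%:M - Pi *+ 2) = v - (v *m Pi) *+ 2.
  by rewrite mulmxBr mulmx1 !mulr2n mulmxDr.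
have JJ : J *m J = 1%:M.
  have hs : (1%:M + J) *m J = 1%:M + J by rewrite -SySy -mulmxA SyJ.
  by move: hs; rewrite mulmxDl mul1mx [1%:M + J]addrC => /addrI.
have E : (kermx ((1%:M - Pi *+ 2) *m J - 1%:M) :=: K0 *m Sy + K1 *m As)%MS.
  apply/eqmxP/andP; split.
    set v := kermx _.
    have vU : v *m (1%:M - Pi *+ 2) *m J = v.
      have := mulmx_ker ((1%:M - Pi *+ 2) *m J - 1%:M).
      by rewrite mulmxBr mulmx1 mulmxA => /eqP; rewrite subr_eq0 => /eqP.
    clearbody v.
    have vJ : v *m J = v - (v *m Pi) *+ 2.
      by rewrite -{1}vU -mulmxA JJ mulmx1 mulB2.
    (* [Pi] changes sign under 1 - 2 Pi, so applying it to vJ = v (1 - 2 Pi) gives -v Pi. *)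
    have vJPi : v *m J *m Pi = - (v *m Pi).
      by rewrite vJ mulmxBl mulr2n mulmxDl -[v *m Pi *m Pi]mulmxA Pi_idem opprD addNKr.
    (* Split v into v(1 + J)/2 and v(1 - J)/2: by [vJPi] the first is killed by [Pi], and by [vJ] as
       well the second is fixed by it. *)
    have -> : v = 2^-1 *: (v *m Sy^T *m Sy) + 2^-1 *: (v *m As^T *m As).
      rewrite -!mulmxA SySy AsAs mulmxDr mulmxBr mulmx1 -scalerDr addrACA subrr addr0.
      exact: half2.
    rewrite addmx_sub_adds// scalemx_sub// submxMr//; apply/sub_kermxP.
      rewrite mulmxA -[v *m _ *m Sy]mulmxA SySy mulmxDr mulmx1 mulmxDl vJPi.
      by rewrite subrr.
    rewrite mulmxA -[v *m _ *m As]mulmxA AsAs mulmxBr mulmx1 mulmxBr mulmx1 mulmxBl.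
    by rewrite vJPi opprK vJ opprB addrCA subrr addr0 mulr2n subrr.
  rewrite addsmx_sub; apply/andP; split; apply/sub_kermxP.
    rewrite mulmxBr mulmx1 mulmxA mulB2 K0e mul0rn subr0.
    by rewrite -mulmxA SyJ subrr.
  rewrite mulmxBr mulmx1 mulmxA mulB2 K1e mulr2n opprD addrA subrr add0r.
  by rewrite mulNmx -mulmxA AsJ mulmxN opprK subrr.
(* The sum is direct because [J] acts as +1 on one summand and as -1 on the other. *)
have D m k (X : 'M[C]_(m, e)) (Y : 'M[C]_(k, e)) : (X *m Sy :&: Y *m As = 0)%MS.
  apply/eqP; rewrite -submx0; apply/rV_subP => w; rewrite sub_capmx.
  move=> /andP[/submxP[c wc] /submxP[d wd]]; rewrite submx0.
  have w1 : w *m J = w by rewrite wc -!mulmxA SyJ.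
  have w2 : w *m J = - w by rewrite wd -!mulmxA AsJ !mulmxN.
  by rewrite [w]half2 -{2}w1 w2 subrr scaler0.
by rewrite E mxrank_disjoint_sum ?D// (mxrankMfree _ Sy_free) (mxrankMfree _ As_free).
Qed.

(* For a graph: the vectors of edge integrals of the 1-forms in the range of A. *)
Definition range_space := kermx (I1 *m Pi *m cokermx (Sy *m Pi)).

(** [c *m Sy + w *m I1] is the boundary row of a function with initial values c and increments w
    along the edges; the condition asks that some choice of c make it admissible. *)
Lemma range_spaceP (w : 'rV[C]_e) :
  reflect (exists c : 'rV_e, (c *m Sy + w *m I1) *m Pi = 0) (w <= range_space)%MS.
Proof.
apply: (iffP sub_kermxP) => [/eqP|[c h]].
  rewrite !(mulmxA w) -submxE => /submxP[D hD]; exists (- D).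
  by rewrite mulmxDl hD mulNmx mulNmx mulmxA addNr.
apply/eqP; rewrite !(mulmxA w) -submxE; apply/submxP; exists (- c).
by apply/eqP; rewrite mulNmx -addr_eq0 (mulmxA c) addrC -mulmxDl h.
Qed.

(** The codimension is the rank of [I1 *m Pi] modulo the rows of [Sy *m Pi]. Modulo these rows
    [I0 *m Pi] is the negative of [I1 *m Pi], so the latter already spans the whole quotient, and
    [rank_Pi_eq] gives its dimension. *)
Lemma rank_range_spaceC : \rank (range_space^C)%MS = \rank (kermx (As *m (1%:M - Pi))).
Proof.
rewrite mxrank_compl [\rank range_space]mxrank_ker subKn ?rank_leq_row//.
have : Sy *m Pi *m cokermx (Sy *m Pi) = 0 by exact: mulmx_coker.
have : (kermx (cokermx (Sy *m Pi)) :=: Sy *m Pi)%MS.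
  apply/eqmxP/andP; split; last by apply/sub_kermxP; exact: mulmx_coker.
  by rewrite submxE mulmx_ker.
move: (cokermx _) => Z kZ SyZ.
have Z0 : I0 *m Pi *m Z = - (I1 *m Pi *m Z).
  by apply/eqP; rewrite -addr_eq0 -!mulmxDl SyZ.
have -> : \rank (I1 *m Pi *m Z) = \rank (Pi *m Z).
  have PZ : Pi *m Z = (I1^T - I0^T) *m (I1 *m Pi *m Z).
    rewrite mulmxBl -[I0^T *m _]opprK -mulmxN -Z0 opprK -!(mulmxA _ Pi) !(mulmxA _^T).
    by rewrite -mulmxDl [_^T *m _ + _]addrC Isum mul1mx.
  by apply/eqP; rewrite eqn_leq {2}PZ -(mulmxA I1) !mxrankM_maxr.
have := mxrank_mul_ker Pi Z; rewrite -rank_Pi_eq.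
rewrite (cap_eqmx (eqmx_refl Pi) kZ) capmxC (capmx_idPl (submxMl _ _)).
by rewrite addnC => /addnI.
Qed.

End ReflectionPair.

(** * Matrices of the graph *)

Section GraphMatrices.
Context (R : realType) (G : quantum_graph R).
Notation C := R[i].
Notation nE := #|{: edge G}|.
Notation nB := #|{: bond G}|.

Definition end_mx (b : bool) : 'M[C]_(nE, nB) :=
  \matrix_(j, l) (enum_val l == (enum_val j, b))%:R.

Definition reverse_mx : 'M[C]_nB :=
  \matrix_(j, l) (enum_val j == bond_end (enum_val l))%:R.

Definition vertex_mx (v : vertex G) : 'M[C]_(degree v, nB) :=
  \matrix_(i, l) (@enum_val _ (mem (ends v)) i == enum_val l)%:R.

Lemma sum_enum_val (I : finType) (F : I -> C) :
  \sum_(j < #|I|) F (enum_val j) = \sum_i F i.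
Proof.
rewrite (reindex (@enum_val I predT)); last exact/onW_bij/enum_val_bij.
exact: eq_bigl.
Qed.

Lemma sum_delta (I : finType) (F : I -> C) i : \sum_k F k * (k == i)%:R = F i.
Proof.
rewrite (bigD1 i)//= eqxx mulr1 big1 ?addr0// => k /negbTE ->.
by rewrite mulr0.
Qed.

Lemma mul_end_mx_tr (b b' : bool) : end_mx b *m (end_mx b')^T = (b == b')%:R%:M.
Proof.
apply/matrixP => j l; rewrite !mxE.
under eq_bigr do rewrite !mxE.
rewrite (sum_enum_val (fun k => (k == (enum_val j, b))%:R * (k == (enum_val l, b'))%:R)).
rewrite sum_delta xpair_eqE (inj_eq enum_val_inj) eq_sym [b' == b]eq_sym.
by case: (j == l); rewrite /= ?mulr1n.
Qed.

Lemma sum_end_mx : (end_mx false)^T *m end_mx false + (end_mx true)^T *m end_mx true = 1%:M.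
Proof.
apply/matrixP => j l; rewrite !mxE -big_split /=.
under eq_bigr do rewrite !mxE.
rewrite (sum_enum_val (fun k => (enum_val j == (k, false))%:R * (enum_val l == (k, false))%:R +
  (enum_val j == (k, true))%:R * (enum_val l == (k, true))%:R)).
rewrite -(inj_eq enum_val_inj).
case: (enum_val j) (enum_val l) => [e b] [e' b'].
under eq_bigr do rewrite !xpair_eqE.
case: b; case: b'; rewrite /= ?xpair_eqE.
- under eq_bigr do rewrite !andbF !andbT mul0r add0r (eq_sym e').
  by rewrite sum_delta andbT.
- by rewrite big1 ?andbF// => k _; rewrite !andbF mul0r mulr0 addr0.
- by rewrite big1 ?andbF// => k _; rewrite !andbF mul0r mulr0 addr0.
- under eq_bigr do rewrite !andbF !andbT mul0r addr0 (eq_sym e').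
  by rewrite sum_delta andbT.
Qed.

Lemma end_mx_real b : map_mx Num.conj (end_mx b) = end_mx b.
Proof. by apply/matrixP => j l; rewrite !mxE rmorph_nat. Qed.

Lemma mul_reverse_mx m (X : 'M[C]_(m, nB)) i l :
  (X *m reverse_mx) i l = X i (enum_rank (bond_end (enum_val l))).
Proof.
rewrite mxE; under eq_bigr => k _.
  rewrite mxE -[bond_end _]enum_rankK (inj_eq enum_val_inj).
  over.
exact: sum_delta.
Qed.

Lemma bond_endK : involutive (@bond_end R G).
Proof. by case=> e b; rewrite /bond_end /= negbK. Qed.

Lemma end_mx_reverse b : end_mx b *m reverse_mx = end_mx (~~ b).
Proof.
apply/matrixP => j l; rewrite mul_reverse_mx !mxE enum_rankK.
by case: (enum_val l) => e b'; rewrite /bond_end /= !xpair_eqE; case: b b' => [] [].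
Qed.

(** Puts bond reversal into the form of the involution [J] of the reflection pair. *)
Lemma reverse_mxE : reverse_mx =
  (end_mx false)^T *m end_mx true + (end_mx true)^T *m end_mx false.
Proof.
rewrite -[LHS]mul1mx -sum_end_mx mulmxDl -!mulmxA !end_mx_reverse.
by [].
Qed.

Lemma reverse_mx_herm : (reverse_mx ^t*)%sesqui = reverse_mx.
Proof.
apply/matrixP => j l; rewrite !mxE rmorph_nat.
by rewrite -(inj_eq (inv_inj bond_endK)) bond_endK eq_sym.
Qed.

Lemma reverse_mxK : reverse_mx *m reverse_mx = 1%:M.
Proof.
apply/matrixP => j l; rewrite mul_reverse_mx !mxE enum_rankK.
by rewrite bond_endK (inj_eq enum_val_inj).
Qed.

Lemma enum_val_ends (v : vertex G) (i : 'I_(degree v)) :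
  endpoint (@enum_val _ (mem (ends v)) i) = v.
Proof. by have := enum_valP i; rewrite inE => /eqP. Qed.

Lemma end_indexK (d d' : edge G * bool) : endpoint d' = endpoint d ->
  @enum_val _ (mem (ends (endpoint d))) (end_index d d') = d'.
Proof. by move=> h; apply: enum_rankK_in; rewrite inE h. Qed.

Lemma mul_vertex_mx_tr v : vertex_mx v *m (vertex_mx v)^T = 1%:M.
Proof.
apply/matrixP => i j; rewrite !mxE.
under eq_bigr do rewrite !mxE.
rewrite (sum_enum_val (fun k => (enum_val i == k)%:R * (enum_val j == k)%:R)).
under eq_bigr do rewrite (eq_sym (enum_val j)).
by rewrite sum_delta (inj_eq enum_val_inj).
Qed.

Lemma mul_vertex_mx_tr_neq v w : v != w -> vertex_mx v *m (vertex_mx w)^T = 0.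
Proof.
move=> vw; apply/matrixP => i j; rewrite !mxE big1// => k _; rewrite !mxE.
case: eqP => [e1|]; last by rewrite mul0r.
case: eqP => [e2|]; last by rewrite mulr0.
by move: vw; rewrite -(enum_val_ends i) -(enum_val_ends j) e1 e2 eqxx.
Qed.

Lemma vertex_mx_real v : map_mx Num.conj (vertex_mx v) = vertex_mx v.
Proof. by apply/matrixP => j l; rewrite !mxE rmorph_nat. Qed.

Variable P : vertex_conditions G.
Hypothesis hP : forall v, orthogonal_projector (P v).

(** The edge ends are partitioned by the vertices, so this is block diagonal with blocks [M v],
    written in the enumeration of bonds. *)
Definition global_mx (M : forall v : vertex G, 'M[C]_(degree v)) : 'M[C]_nB :=
  \sum_v (vertex_mx v)^T *m M v *m vertex_mx v.

Lemma global_mxE (M : forall v, 'M[C]_(degree v)) j l :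
  let b := enum_val j in let d := enum_val l in
  global_mx M j l = if endpoint b == endpoint d then
    M (endpoint b) (end_index b b) (end_index b d) else 0.
Proof.
move=> b d; rewrite summxE (bigD1 (endpoint b))//= big1 ?addr0 => [|w wb]; last first.
  rewrite mxE big1// => k _; rewrite mxE big1 ?mul0r// => k' _; rewrite !mxE.
  case: eqP => [e|]; last by rewrite mul0r.
  by case/eqP: wb; rewrite /b -e enum_val_ends.
have vb i : vertex_mx (endpoint b) i j = (i == end_index b b)%:R.
  by rewrite mxE -/b -{2}(@end_indexK b b erefl) (inj_eq enum_val_inj).
rewrite mxE; under eq_bigr => k _.
  rewrite mxE; under eq_bigr do rewrite mxE vb mulrC.
  rewrite sum_delta; over.
case: eqP => [bd|bd]; last first.
  rewrite /= big1// => k _; rewrite !mxE; case: eqP => [e|]; last by rewrite mulr0.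
  by case: bd; rewrite /d -e enum_val_ends.
have vd i : vertex_mx (endpoint b) i l = (i == end_index b d)%:R.
  by rewrite mxE -/d -{1}(@end_indexK b d (esym bd)) (inj_eq enum_val_inj).
under eq_bigr do rewrite vd.
exact: sum_delta.
Qed.

Lemma global_mxM M N : global_mx M *m global_mx N = global_mx (fun v => M v *m N v).
Proof.
rewrite mulmx_suml; apply: eq_bigr => v _; rewrite mulmx_sumr (bigD1 v)//= big1.
  by rewrite addr0 -!mulmxA (mulmxA (vertex_mx v)) mul_vertex_mx_tr mul1mx.
by move=> w wv; rewrite -!mulmxA (mulmxA (vertex_mx v)) mul_vertex_mx_tr_neq 1?eq_sym// mul0mx !mulmx0.
Qed.

Lemma global_mx1 : global_mx (fun=> 1%:M) = 1%:M.
Proof.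
apply/matrixP => j l; rewrite global_mxE !mxE.
case: eqP => [e|ne].
  by rewrite -(inj_eq enum_val_inj) !end_indexK// (inj_eq enum_val_inj).
by case: eqP => // jl; case: ne; rewrite jl.
Qed.

(** The rank of an idempotent is its trace, and traces add over the blocks. *)
Lemma global_mx_rank M : (forall v, M v *m M v = M v) ->
  \rank (global_mx M) = (\sum_v \rank (M v))%N.
Proof.
(* With A = c r its rank factorization, cancelling one-sided inverses in A A = A gives r c = 1,
   whose trace is the rank. *)
have trK n (A : 'M[C]_n) : A *m A = A -> \tr A = (\rank A)%:R.
  move=> AA; rewrite -{1}(mulmx_base A) mxtrace_mulC.
  suff -> : row_base A *m col_base A = 1%:M by rewrite mxtrace1.
  have [Y hY] := row_freeP (row_base_free A).
  have [X hX] := row_fullP (col_base_full A).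
  move: (mulmx_base A) hX hY AA.
  move: (\rank A) (col_base A) (row_base A) X Y => k c r X Y <- hX hY.
  move=> /(congr1 (fun Z => X *m Z *m Y)).
  by rewrite !mulmxA hX !mul1mx -!mulmxA hY mulmx1.
move=> MM; apply/eqP; rewrite -(eqr_nat C) -trK; last first.
  by rewrite global_mxM; apply: eq_bigr => v _; rewrite MM.
rewrite raddf_sum natr_sum /=; apply/eqP; apply: eq_bigr => v _.
by rewrite mxtrace_mulC mulmxA mul_vertex_mx_tr mul1mx trK.
Qed.

End GraphMatrices.

(** * The scattering matrix *)

Lemma global_mx_herm (R : realType) (G : quantum_graph R)
    (M : forall v : vertex G, 'M[R[i]]_(degree v)) :
  (forall v, ((M v) ^t*)%sesqui = M v) -> ((global_mx M) ^t*)%sesqui = global_mx M.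
Proof.
move=> hM; rewrite /global_mx raddf_sum raddf_sum; apply: eq_bigr => v _ /=.
rewrite !trmx_mul !map_mxM trmxK vertex_mx_real hM -map_trmx vertex_mx_real.
by rewrite mulmxA.
Qed.

(** * Vertex scattering matrices as reflections *)

Section VertexScattering.
Variables (R : realType).

Lemma derive1_cos_sin (a b k : R) :
  derive1 (fun x => a * cos (k * x) + b * sin (k * x)) 0 = b * k.
Proof.
rewrite derive1E.
have dk : is_derive (0 : R) 1 (fun x => k * x) k.
  by apply: is_derive_eq; rewrite [_ *: _]mulr1.
have dc : is_derive (0 : R) 1 (fun x => cos (k * x)) 0.
  have := is_derive1_comp (is_derive_cos (k * 0)) dk.
  by rewrite mulr0 sin0 oppr0 mul0r.
have ds : is_derive (0 : R) 1 (fun x => sin (k * x)) k.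
  have := is_derive1_comp (is_derive_sin (k * 0)) dk.
  by rewrite mulr0 cos0 mul1r.
have da : is_derive (0 : R) 1 (fun x => a * cos (k * x)) (a * 0).
  exact: is_deriveZ.
have db : is_derive (0 : R) 1 (fun x => b * sin (k * x)) (b * k).
  exact: is_deriveZ.
have := @is_deriveD _ _ _ _ _ _ _ _ _ da db.
by rewrite mulr0 add0r => d; rewrite derive_val.
Qed.

Lemma cexp_i (y : R) : cexp (0 +i* y) = cos y +i* sin y.
Proof. by rewrite cexpE /= expR0 !mul1r. Qed.

Section StarWave.
Variables (n : nat) (s : 'M[R[i]]_n) (k : R) (i0 i : 'I_n).

Let ikx (x : R) : 'i%C * k%:C * x%:C = 0 +i* (k * x).
Proof. by simpc. Qed.

(** [cderive1] differentiates real and imaginary parts separately, so the wave is written as two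
    real combinations of cosine and sine. *)
Lemma star_waveE x : star_wave s k i0 i x =
  (((i == i0)%:R + complex.Re (s i0 i)) * cos (k * x) + (- complex.Im (s i0 i)) * sin (k * x)) +i*
  (complex.Im (s i0 i) * cos (k * x) + (complex.Re (s i0 i) - (i == i0)%:R) * sin (k * x)).
Proof.
rewrite /star_wave ikx; have -> : - (0 +i* (k * x)) = 0 +i* (- (k * x)) by simpc.
rewrite !cexp_i cosN sinN; case: (s i0 i) => a b /=.
by case: (i == i0) => /=; simpc; apply/eqP; rewrite eq_complex /=; apply/andP; split; apply/eqP; ring.
Qed.

Lemma star_wave0 : star_wave s k i0 i 0 = (i == i0)%:R + s i0 i.
Proof.
rewrite /star_wave ikx mulr0 oppr0.
have -> : 0 +i* 0 = 0 :> R[i] by [].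
by rewrite cexp0 !mulr1.
Qed.

Lemma cderive1_star_wave : cderive1 (star_wave s k i0 i) 0 =
  'i%C * k%:C * (s i0 i - (i == i0)%:R).
Proof.
have := derive1_cos_sin ((i == i0)%:R + complex.Re (s i0 i)) (- complex.Im (s i0 i)) k.
have := derive1_cos_sin (complex.Im (s i0 i)) (complex.Re (s i0 i) - (i == i0)%:R) k.
rewrite /cderive1.
have -> : (fun y => complex.Re (star_wave s k i0 i y)) = (fun x =>
  ((i == i0)%:R + complex.Re (s i0 i)) * cos (k * x) + (- complex.Im (s i0 i)) * sin (k * x)).
  by apply/funext => x; rewrite star_waveE.
have -> : (fun y => complex.Im (star_wave s k i0 i y)) = (fun x =>
  complex.Im (s i0 i) * cos (k * x) + (complex.Re (s i0 i) - (i == i0)%:R) * sin (k * x)).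
  by apply/funext => x; rewrite star_waveE.
move=> -> ->; case: (s i0 i) => a b /=.
by case: (i == i0) => /=; simpc; apply/eqP; rewrite eq_complex /=; apply/andP; split; apply/eqP; ring.
Qed.

End StarWave.

(** The two vertex conditions read P (1 + s^T) = 0 and (1 - P)(s^T - 1) = 0; adding the information
    on both ranges leaves only s^T = 1 - 2P. The transpose appears because row i0 of s holds the
    wave sent in along i0. *)
Lemma vertex_scatteringE n (P : 'M[R[i]]_n) : orthogonal_projector P ->
  vertex_scattering P = 1%:M - P^T *+ 2.
Proof.
move=> [PP _].
have col_mul (A B : 'M[R[i]]_n) j : col j (A *m B) = A *m col j B.
  by rewrite !colE mulmxA.
have c0 s k i0 : \col_i star_wave s k i0 i 0 = col i0 (1%:M + s^T) :> 'cV[R[i]]_n.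
  by apply/colP => i; rewrite !mxE star_wave0.
have c1 s k i0 : \col_i cderive1 (star_wave s k i0 i) 0 =
    ('i%C * k%:C) *: col i0 (s^T - 1%:M) :> 'cV[R[i]]_n.
  by apply/colP => i; rewrite !mxE cderive1_star_wave.
have h0 : is_vertex_scattering P (1%:M - P^T *+ 2).
  move=> k k0 i0; rewrite c0 c1 -scalemxAr -!col_mul.
  have -> : (1%:M - P^T *+ 2)^T = 1%:M - P *+ 2.
    by rewrite linearB /= trmx1 linearMn /= trmxK.
  rewrite !mulr2n; split.
    rewrite mulmxDr mulmxBr mulmx1 mulmxDr PP addrA subrr.
    by apply/colP => i; rewrite !mxE.
  rewrite addrAC subrr add0r mulmxN mulmxDr mulmxBl mul1mx PP subrr addr0 oppr0.
  by rewrite col0 scaler0.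
have u s : is_vertex_scattering P s -> s = 1%:M - P^T *+ 2.
  (* One value of k determines s, as k enters only through the nonzero factor ik of the
     derivatives. *)
  move=> hs; have {hs} := hs 1 (oner_neq0 _) => hs.
  have e0 : P *m (1%:M + s^T) = 0.
    apply/matrixP => i j; have := (hs j).1; rewrite c0 -col_mul.
    by move=> /colP/(_ i); rewrite [LHS]mxE => ->; rewrite !mxE.
  have e1 : (1%:M - P) *m (s^T - 1%:M) = 0.
    apply/matrixP => i j; have := (hs j).2; rewrite c1 -scalemxAr -col_mul.
    move=> /eqP; rewrite scaler_eq0 => /orP[|/eqP/colP/(_ i)]; last first.
      by rewrite [LHS]mxE => ->; rewrite !mxE.
    by rewrite mulr1 eq_complex /= oner_eq0 andbF.
  have : s^T = 1%:M - P *+ 2.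
    move: e0 e1; rewrite mulmxDr mulmx1 => /eqP; rewrite addrC addr_eq0 => /eqP e0.
    rewrite mulmxBl mul1mx mulmxBr mulmx1 e0 => /eqP; rewrite subr_eq0 => /eqP.
    by rewrite -opprD -mulr2n => /eqP; rewrite subr_eq addrC => /eqP.
  by move=> /(congr1 trmx); rewrite trmxK linearB /= trmx1 linearMn /=.
by apply: u; apply: xgetPex; exists (1%:M - P^T *+ 2).
Qed.

End VertexScattering.

(** * The global scattering matrix as a product of two reflections *)

Section Evolution.
Context (R : realType) (G : quantum_graph R) (P : vertex_conditions G).
Hypothesis hP : forall v, orthogonal_projector (P v).

(* Boundary values are treated as row vectors, hence the transposes: the
   conditions P_v F(v) = 0 together read F *m projector_mx = 0. *)
Definition projector_mx : 'M[R[i]]_#|{: bond G}| := global_mx (fun v => (P v)^T).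

Lemma projector_mx_idem : projector_mx *m projector_mx = projector_mx.
Proof.
rewrite global_mxM; apply: eq_bigr => v _.
by rewrite -trmx_mul (hP v).1.
Qed.

Lemma projector_mx_herm : (projector_mx ^t*)%sesqui = projector_mx.
Proof.
apply: global_mx_herm => v; rewrite trmxK.
by rewrite -[in RHS](hP v).2 map_trmx trmxK.
Qed.

Lemma projector_mx_rank : \rank projector_mx = dirichlet_count P.
Proof.
rewrite global_mx_rank => [|v]; last by rewrite -trmx_mul (hP v).1.
by apply: eq_bigr => v _; rewrite mxrank_tr.
Qed.

(** A wave on a bond arrives at the edge end where the reversed bond starts: reversal comes first,
    then reflection at the vertices. *)
Lemma scattering_mxE : scattering_matrix P = (1%:M - projector_mx *+ 2) *m reverse_mx G.
Proof.
have -> : 1%:M - projector_mx *+ 2 = global_mx (fun v => 1%:M - (P v)^T *+ 2).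
  rewrite -global_mx1 /projector_mx /global_mx -sumrMnl -sumrB.
  by apply: eq_bigr => v _; rewrite mulmxBr mulmxBl !mulr2n mulmxDr mulmxDl.
apply/matrixP => j l; rewrite mul_reverse_mx global_mxE mxE /scattering_entry.
by rewrite enum_rankK vertex_scatteringE.
Qed.

(** Both factors are Hermitian involutions. *)
Lemma scattering_mx_unitary :
  scattering_matrix P *m ((scattering_matrix P) ^t*)%sesqui = 1%:M.
Proof.
rewrite scattering_mxE trmx_mul map_mxM reverse_mx_herm -mulmxA.
rewrite (mulmxA (reverse_mx G)) reverse_mxK mul1mx.
have -> : ((1%:M - projector_mx *+ 2) ^t*)%sesqui = 1%:M - projector_mx *+ 2.
  rewrite linearB /= trmx1 map_mxB map_mx1 linearMn /= raddfMn /=.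
  by rewrite projector_mx_herm.
rewrite !mulr2n mulmxBr mulmx1 mulmxDr !mulmxBl !mul1mx mulmxDl projector_mx_idem.
have -> : projector_mx - (projector_mx + projector_mx) = - projector_mx.
  by rewrite opprD addrA subrr sub0r.
by rewrite -opprD opprK subrK.
Qed.

Lemma secular_vanishing_order :
  vanishing_order0 (secular P)
    (\rank (kermx ((1%:M - projector_mx *+ 2) *m reverse_mx G - 1%:M))).
Proof.
rewrite mxrank_ker -scattering_mxE.
by apply: vanishing_order0_det => [|j]; [exact: scattering_mx_unitary|exact: len_gt0].
Qed.

End Evolution.

(** * The operators *)

Section Functions.
Context (R : realType) (G : quantum_graph R).
Notation C := R[i].
Notation nE := #|{: edge G}|.
Notation mu := (@lebesgue_measure R).
Implicit Types f g h : graph_fun G.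

Lemma len_ge0 (e : edge G) : 0 <= len e.
Proof. exact: ltW (len_gt0 e). Qed.

Lemma L2_csquare_integrable f e : L2 f -> csquare_integrable (len e) (f e).
Proof. by move=> hf; have [] := hf e. Qed.

Definition const_fun (c : 'rV[C]_nE) : graph_fun G := fun e _ => c 0 (enum_rank e).

Definition primitive_fun (c : 'rV[C]_nE) g : graph_fun G :=
  fun e x => c 0 (enum_rank e) + complex_integral `[0, x]%classic (g e).

Definition integral_row g : 'rV[C]_nE :=
  \row_j complex_integral `[0, len (enum_val j)]%classic (g (enum_val j)).

Definition sub_fun f g : graph_fun G := fun e x => f e x - g e x.

(** Converts prescribed edge integrals into the values of the edgewise constant form that has
    them. *)
Definition inv_len_mx : 'M[C]_nE := diag_mx (\row_j ((len (enum_val j))^-1)%:C).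

Lemma L2_const c : L2 (const_fun c).
Proof. by move=> e; exact: csquare_integrable_cst. Qed.

Lemma L2_0 : L2 (graph_fun0 (G := G)).
Proof. by move=> e; exact: (csquare_integrable_cst _ 0). Qed.

Lemma L2B f g : L2 f -> L2 g -> L2 (sub_fun f g).
Proof. by move=> hf hg e; exact: csquare_integrableB (hf e) (hg e). Qed.

Lemma L2_primitive c g : L2 g -> L2 (primitive_fun c g).
Proof. by move=> hg e; exact: csquare_integrable_prim (len_ge0 e) (hg e). Qed.

Lemma eq_ae_equal f g : (forall e x, 0 <= x <= len e -> f e x = g e x) -> ae_equal f g.
Proof.
move=> h e; apply: aeW => x; rewrite /= in_itv /=; exact: h.
Qed.

Lemma ae_equal_trans f g h : ae_equal f g -> ae_equal g h -> ae_equal f h.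
Proof. by move=> fg gh e; apply: ae_eq_in_imp2 (fg e) (gh e) => x _ ->. Qed.

Lemma ae_equal_sub0 f g : ae_equal f g -> ae_equal (sub_fun f g) (graph_fun0 (G := G)).
Proof. by move=> fg e; apply: ae_eq_in_imp (fg e) => x _; rewrite /sub_fun => ->; rewrite subrr. Qed.

Lemma ae_equal_of_sub0 f g : ae_equal (sub_fun f g) (graph_fun0 (G := G)) -> ae_equal f g.
Proof. by move=> fg e; apply: ae_eq_in_imp (fg e) => x _ /eqP; rewrite subr_eq0 => /eqP. Qed.

Lemma integral_row_const c : integral_row (const_fun (c *m inv_len_mx)) = c.
Proof.
apply/rowP => j; rewrite mxE /const_fun (complex_integral_cst _ (len_ge0 _)).
rewrite mul_mx_diag !mxE enum_valK -mulrA -rmorphM mulVf ?mulr1//.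
by rewrite gt_eqF// len_gt0.
Qed.

Lemma integral_rowB f g : L2 f -> L2 g ->
  integral_row (sub_fun f g) = integral_row f - integral_row g.
Proof.
move=> hf hg; apply/rowP => j; rewrite !mxE complex_integralB//.
  exact: csquare_integrable_cintegrable (hf _).
exact: csquare_integrable_cintegrable (hg _).
Qed.

Lemma integral_row0 f : L2 f -> ae_equal f (graph_fun0 (G := G)) -> integral_row f = 0.
Proof.
move=> hf f0; apply/rowP => j; rewrite !mxE.
exact: ae_eq0_complex_integral (hf _) (lexx _) (f0 _).
Qed.

Lemma const_fun_ae0 c : ae_equal (const_fun c) (graph_fun0 (G := G)) -> c = 0.
Proof.
move=> /(integral_row0 (L2_const c)) => h; apply/rowP => j.
move/rowP/(_ j): h; rewrite !mxE (complex_integral_cst _ (len_ge0 _)) enum_valK.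
move=> /eqP; rewrite mulf_eq0 => /orP[/eqP//|].
by rewrite -[0]/(0%:C) (inj_eq (@complexI _)) gt_eqF// len_gt0.
Qed.

Lemma inner_ae f f' g g' : L2 f -> L2 f' -> L2 g -> L2 g' ->
  ae_equal f f' -> ae_equal g g' -> inner f g = inner f' g'.
Proof.
move=> hf hf' hg hg' ff gg; apply: eq_bigr => e _.
by apply: ae_eq_complex_integral_mulJ => //; exact: L2_csquare_integrable.
Qed.

Lemma inner0r f : inner f (graph_fun0 (G := G)) = 0.
Proof.
apply: big1 => e _; rewrite -[RHS](@complex_integral0 _ `[0, len e]%classic).
by apply: eq_complex_integral => x _; rewrite rmorph0 mulr0.
Qed.

Lemma inner0l f : inner (graph_fun0 (G := G)) f = 0.
Proof.
apply: big1 => e _; rewrite -[RHS](@complex_integral0 _ `[0, len e]%classic).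
by apply: eq_complex_integral => x _; exact: mul0r.
Qed.

Lemma innerBr f g h : L2 f -> L2 g -> L2 h ->
  inner f (sub_fun g h) = inner f g - inner f h.
Proof.
move=> hf hg hh; rewrite /inner -sumrB; apply: eq_bigr => e _.
rewrite -complex_integralB; try (apply: csquare_integrable_mulJ; exact: L2_csquare_integrable).
by apply: eq_complex_integral => x _; rewrite rmorphB mulrBr.
Qed.

Lemma inner_const g c : L2 g ->
  inner g (const_fun c) = (integral_row g *m (c ^t*)%sesqui) 0 0.
Proof.
move=> hg; rewrite mxE -[LHS]sum_enum_val; apply: eq_bigr => j _.
rewrite !mxE /const_fun complex_integralZ ?enum_valK//.
exact/csquare_integrable_cintegrable/L2_csquare_integrable.
Qed.

Lemma inner_self_eq0 f : L2 f -> inner f f = 0 -> ae_equal f (graph_fun0 (G := G)).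
Proof.
move=> hf /eqP; rewrite psumr_eq0 => [/allP h e|e _]; last exact: complex_integral_mulJ_ge0.
apply: complex_integral_mulJ_eq0 (L2_csquare_integrable _ hf) _.
by have := h e (mem_index_enum _); rewrite implyTb => /eqP.
Qed.

Lemma primitive_fun_ae0 c g : L2 g -> ae_equal g (graph_fun0 (G := G)) ->
  ae_equal (primitive_fun c g) (const_fun c).
Proof.
move=> hg g0; apply: eq_ae_equal => e x /andP[_ xl]; rewrite /primitive_fun.
by rewrite (ae_eq0_complex_integral (hg e) xl (g0 e)) addr0.
Qed.

(** Every quotient space considered has edgewise constant representatives, with a basis taken from
    [row_base K]. [S] is the identity for kernels, parametrized by values, and [inv_len_mx] for the
    cokernel, parametrized by edge integrals. *)
Lemma quotient_dim_const (X W : set (graph_fun G)) q (K : 'M[C]_(q, nE)) (S : 'M[C]_nE) :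
  (forall v : 'rV_nE, (v <= K)%MS -> X (const_fun (v *m S))) ->
  (forall v : 'rV_nE, (v <= K)%MS -> W (const_fun (v *m S)) -> v = 0) ->
  (forall f, X f -> exists2 v : 'rV_nE, (v <= K)%MS & W (sub_fun f (const_fun (v *m S)))) ->
  quotient_dim X W (\rank K).
Proof.
move=> hX hW hXW; exists (fun i => const_fun (row i (row_base K) *m S)).
have comb (c : 'I_(\rank K) -> C) :
    (fun e x => \sum_i c i * const_fun (row i (row_base K) *m S) e x) =
    const_fun ((\row_i c i) *m row_base K *m S).
  apply/funext => e; apply/funext => x; rewrite /const_fun.
  move: (row_base K) => B; rewrite -mulmxA [RHS]mxE.
  by apply: eq_bigr => i _; rewrite -row_mul [row _ _ _ _]mxE [(\row__ _) _ _]mxE.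
split=> [i|c|f Xf].
- by apply: hX; rewrite (submx_trans (row_sub _ _))// eq_row_base.
- rewrite comb => /hW h i.
  have := h; rewrite (submx_trans (submxMl _ _)) ?eq_row_base// => /(_ isT) /eqP.
  rewrite (mulmx_free_eq0 _ (row_base_free K)) => /eqP /rowP /(_ i).
  by rewrite !mxE.
- have [v + Wv] := hXW f Xf; rewrite -(eq_row_base K) => /submxP[c vc].
  exists (c 0).
  suff -> : (fun e x => f e x - \sum_i c 0 i * const_fun (row i (row_base K) *m S) e x) =
      sub_fun f (const_fun (v *m S)) by [].
  apply/funext => e; apply/funext => x; rewrite /sub_fun; congr (_ - _).
  have -> : v = (\row_i c 0 i) *m row_base K by rewrite vc; congr (_ *m _); apply/rowP => i; rewrite mxE.
  by rewrite -comb.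
Qed.

End Functions.

(** * Kernels, adjoint and cokernel of A *)

Section Operators.
Context (R : realType) (G : quantum_graph R) (P : vertex_conditions G).
Hypothesis hP : forall v, orthogonal_projector (P v).
Notation C := R[i].
Notation nE := #|{: edge G}|.
Notation nB := #|{: bond G}|.
Notation Pi := (projector_mx P).
Notation Sy := (end_mx G false + end_mx G true).
Notation As := (end_mx G true - end_mx G false).
Notation fun0 := (graph_fun0 (G := G)).
Implicit Types f g h : graph_fun G.

Definition end_row f : 'rV[C]_nB := \row_l end_value f (enum_val l).

Lemma boundary_condP f :
  (forall v, P v *m boundary_values f v = 0) <-> end_row f *m Pi = 0.
Proof.
have bE v : boundary_values f v = (end_row f *m (vertex_mx v)^T)^T.
  apply/colP => i; rewrite !mxE; under eq_bigr do rewrite !mxE.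
  rewrite (sum_enum_val (fun k => end_value f k * (@enum_val _ (mem (ends v)) i == k)%:R)).
  by under eq_bigr do rewrite eq_sym; rewrite sum_delta.
split=> [h|h v].
  rewrite mulmx_sumr big1// => v _; rewrite !mulmxA.
  have := h v; rewrite bE => /(congr1 trmx); rewrite trmx_mul trmxK trmx0 => ->.
  by rewrite mul0mx.
apply: trmx_inj; rewrite bE trmx_mul trmxK trmx0.
(* Multiplication by [(vertex_mx v)^T] isolates the block at v, since the blocks are orthogonal. *)
have := congr1 (mulmx^~ (vertex_mx v)^T) h; rewrite /= mul0mx => e; rewrite -[RHS]e.
rewrite mulmx_sumr mulmx_suml (bigD1 v)//= big1 ?addr0 => [|w wv].
  by rewrite -!mulmxA mul_vertex_mx_tr mulmx1.
by rewrite -!mulmxA mul_vertex_mx_tr_neq// !mulmx0.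
Qed.

Lemma end_row_const_prim f (c w : 'rV[C]_nE) :
  (forall e, f e 0 = c 0 (enum_rank e)) ->
  (forall e, f e (len e) = c 0 (enum_rank e) + w 0 (enum_rank e)) ->
  end_row f = c *m Sy + w *m end_mx G true.
Proof.
move=> h0 h1.
have rE (a : 'rV[C]_nE) b l : (a *m end_mx G b) 0 l =
    if (enum_val l).2 == b then a 0 (enum_rank (enum_val l).1) else 0.
  rewrite mxE; under eq_bigr do rewrite mxE.
  rewrite (eq_bigr (fun j => a 0 (enum_rank (enum_val j)) * (enum_val l == (enum_val j, b))%:R)); last first.
    by move=> j _; rewrite enum_valK.
  rewrite (sum_enum_val (fun k => a 0 (enum_rank k) * (enum_val l == (k, b))%:R)).
  case: (enum_val l) => e b' /=; under eq_bigr do rewrite xpair_eqE.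
  case: eqP => _; last by rewrite big1// => k _; rewrite andbF mulr0.
  by under eq_bigr do rewrite andbT eq_sym; rewrite sum_delta.
rewrite mulmxDr -addrA -mulmxDl; apply/rowP => l; rewrite [RHS]mxE !rE !mxE /end_value.
by case: (enum_val l) => e [] /=; rewrite ?h0 ?h1 ?add0r ?addr0.
Qed.

Lemma extd_primitive (c : 'rV[C]_nE) g : L2 g ->
  (c *m Sy + integral_row g *m end_mx G true) *m Pi = 0 ->
  extd P (primitive_fun c g) g.
Proof.
move=> hg h; split=> //; first exact: L2_primitive.
exists (primitive_fun c g); split=> [e|e x _|].
- by apply: aeW.
- by rewrite /primitive_fun complex_integral_set1 addr0.
- apply/boundary_condP; rewrite (@end_row_const_prim _ c (integral_row g))//.
    by move=> e; rewrite /primitive_fun complex_integral_set1 addr0.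
  by move=> e; rewrite /primitive_fun mxE enum_rankK.
Qed.

(** Together with [extd_primitive] this reduces the domain of A to linear algebra in the initial
    values c and the edge integrals of g. *)
Lemma extdP f g : extd P f g ->
  [/\ L2 f, L2 g & exists2 c : 'rV[C]_nE, ae_equal f (primitive_fun c g) &
  (c *m Sy + integral_row g *m end_mx G true) *m Pi = 0].
Proof.
move=> [hf hg [f0 [ff0 f0E /boundary_condP bc]]]; split=> //.
exists (\row_j f0 (enum_val j) 0).
  apply: ae_equal_trans ff0 _; apply: eq_ae_equal => e x xl.
  by rewrite f0E// /primitive_fun mxE enum_rankK.
rewrite -bc; congr (_ *m _); apply/esym/end_row_const_prim => e.
  by rewrite mxE enum_rankK.
by rewrite !mxE !enum_rankK f0E// lexx len_ge0.
Qed.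

Lemma primitive_fun_0 (c : 'rV[C]_nE) : primitive_fun c fun0 = const_fun c.
Proof.
by apply/funext => e; apply/funext => x; rewrite /primitive_fun complex_integral0 addr0.
Qed.

Lemma const_fun_0 : const_fun 0 = fun0.
Proof. by apply/funext => e; apply/funext => x; rewrite /const_fun mxE. Qed.

Lemma integral_row_0 : integral_row fun0 = 0.
Proof. by apply/rowP => j; rewrite !mxE complex_integral0. Qed.

Lemma extd_const (c : 'rV[C]_nE) : c *m Sy *m Pi = 0 -> extd P (const_fun c) fun0.
Proof.
move=> h; rewrite -primitive_fun_0; apply: extd_primitive; first exact: L2_0.
by rewrite integral_row_0 mul0mx addr0.
Qed.

Lemma extd_0 : extd P fun0 fun0.
Proof. by rewrite -{1}const_fun_0; apply: extd_const; rewrite !mul0mx. Qed.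

Lemma adjoint_0 : adjoint (extd P) fun0 fun0.
Proof. by split=> [||f f' _]; [exact: L2_0|exact: L2_0|rewrite !inner0r]. Qed.

Let I00 : end_mx G false *m (end_mx G false)^T = 1%:M.
Proof. exact: mul_end_mx_tr. Qed.
Let I11 : end_mx G true *m (end_mx G true)^T = 1%:M.
Proof. exact: mul_end_mx_tr. Qed.
Let I01 : end_mx G false *m (end_mx G true)^T = 0.
Proof. by rewrite mul_end_mx_tr raddf0. Qed.
Let I10 : end_mx G true *m (end_mx G false)^T = 0.
Proof. by rewrite mul_end_mx_tr raddf0. Qed.

(** [As^T] takes the difference of the values at the two ends of each edge, that is, the integral of
    the derivative. *)
Lemma end_row_recover (c w : 'rV[C]_nE) :
  (c *m Sy + w *m end_mx G true) *m As^T = w.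
Proof.
rewrite [X in _ *m X]raddfB /= mulmxBr mulmxDr !mulmxDl -!mulmxA I00 I11 I01 I10.
by rewrite !mulmx0 !mulmx1 add0r !addr0 addrC addKr.
Qed.

Lemma end_row_decomp (F : 'rV[C]_nB) :
  F *m (end_mx G false)^T *m Sy + F *m As^T *m end_mx G true = F.
Proof.
rewrite (raddfB (@trmx C nE nB)) /= mulmxBr mulmxBl mulmxDr.
rewrite [_ - _]addrC addrA addrK -!mulmxA -mulmxDr.
by rewrite sum_end_mx mulmx1.
Qed.

(** The pairing is F As^T m^* for an admissible boundary row F = F (1 - Pi), and (1 - Pi) As^T m^*
    is the conjugate transpose of m As (1 - Pi) = 0. *)
Lemma inner_const_extd f g (m : 'rV[C]_nE) : extd P f g ->
  m *m (As *m (1%:M - Pi)) = 0 -> inner g (const_fun m) = 0.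
Proof.
move=> /extdP[_ hg [c _ h]] hm; rewrite inner_const//.
rewrite -(end_row_recover c (integral_row g)).
set F := _ + _ in h *.
have FE : F = F *m (1%:M - Pi) by rewrite mulmxBr mulmx1 h subr0.
suff -> : F *m As^T *m (m ^t*)%sesqui = 0 by rewrite mxE.
rewrite FE; have -> : As^T = (As ^t*)%sesqui by rewrite -map_trmx map_mxB !end_mx_real.
have -> : 1%:M - Pi = ((1%:M - Pi) ^t*)%sesqui.
  by rewrite linearB /= trmx1 map_mxB map_mx1 projector_mx_herm.
by rewrite -!mulmxA -!map_mxM -!trmx_mul -mulmxA hm trmx0 map_mx0 mulmx0.
Qed.

Lemma adjoint_const (m : 'rV[C]_nE) :
  m *m (As *m (1%:M - Pi)) = 0 -> adjoint (extd P) (const_fun m) fun0.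
Proof.
move=> hm; split=> [||f f' ff']; [exact: L2_const|exact: L2_0|].
by rewrite inner0r (inner_const_extd ff').
Qed.

(** Forms with zero edge integrals lie in the range and force g to be edgewise constant; derivatives
    of edgewise affine functions then give the condition on m. *)
Lemma orth_range_const g : L2 g -> (forall f f', extd P f f' -> inner f' g = 0) ->
  exists2 m : 'rV[C]_nE, m *m (As *m (1%:M - Pi)) = 0 & ae_equal g (const_fun m).
Proof.
move=> hg hort; pose m := integral_row g *m inv_len_mx G.
have gm : ae_equal g (const_fun m).
  (* The antiderivative of u = g - (edge means) vanishes at all edge ends. *)
  pose u := sub_fun g (const_fun m); have hu : L2 u by apply: L2B => //; exact: L2_const.
  have iu : integral_row u = 0.
    by rewrite integral_rowB//; [rewrite integral_row_const subrr|exact: L2_const].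
  apply: ae_equal_of_sub0; apply: inner_self_eq0 => //.
  (* As u has zero edge integrals it is orthogonal to edgewise constants, so the pairing of u with
     itself is its pairing with g. *)
  rewrite -/u {2}/u innerBr//; last exact: L2_const.
  rewrite inner_const// iu mul0mx mxE subr0.
  apply: (hort (primitive_fun 0 u)); apply: extd_primitive => //.
  by rewrite iu !mul0mx addr0 mul0mx.
clearbody m; exists m => //.
(* The rows of 1 - Pi span the admissible boundary rows, so they suffice as tests. *)
have key : (1%:M - Pi) *m As^T *m (m ^t*)%sesqui = 0.
  apply/row_matrixP => j; rewrite row0 !row_mul.
  set F := row j (1%:M - Pi).
  have F0 : F *m Pi = 0.
    by rewrite -row_mul mulmxBl mul1mx projector_mx_idem// subrr row0.
  have hc : L2 (const_fun (F *m As^T *m inv_len_mx G)) by exact: L2_const.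
  apply/rowP => k; rewrite (ord1 k) [RHS]mxE.
  rewrite -(integral_row_const (F *m As^T)) -inner_const//.
  rewrite -(inner_ae hc hc hg (L2_const m) _ gm); last by move=> e; exact: aeW.
  (* This edgewise affine function has boundary row F. *)
  apply: (hort (primitive_fun (F *m (end_mx G false)^T) (const_fun (F *m As^T *m inv_len_mx G)))).
  by apply: extd_primitive => //; rewrite integral_row_const end_row_decomp.
have := congr1 (fun X => (X ^t*)%sesqui) key.
rewrite trmx0 map_mx0 !trmx_mul !map_mxM trmxK => <-.
rewrite trmxCK map_mxB !end_mx_real; congr (_ *m (_ *m _)).
by rewrite linearB /= trmx1 map_mxB map_mx1 projector_mx_herm.
Qed.

Lemma kernel_dim_AsA :
  kernel_dim (compose (adjoint (extd P)) (extd P)) (\rank (kermx (Sy *m Pi))).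
Proof.
apply: (@quotient_dim_const _ _ _ _ _ _ 1%:M) => [v|v _|f].
- move=> /sub_kermxP vK; rewrite mulmx1; exists fun0; last exact: adjoint_0.
  by apply: extd_const; rewrite -mulmxA.
- by rewrite mulmx1; exact: const_fun_ae0.
(* Testing the adjoint relation against f itself gives ||Af||^2 = 0. *)
- move=> [g fg [hg _ /(_ _ _ fg)]]; rewrite inner0r => /(inner_self_eq0 hg) g0.
  have [_ _ [c fc bc]] := extdP fg.
  exists c.
    by apply/sub_kermxP; move: bc; rewrite integral_row0// mul0mx addr0 mulmxA.
  rewrite mulmx1; apply: ae_equal_sub0; apply: ae_equal_trans fc _.
  exact: primitive_fun_ae0.
Qed.

Lemma kernel_dim_AAs :
  kernel_dim (compose (extd P) (adjoint (extd P))) (\rank (kermx (As *m (1%:M - Pi)))).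
Proof.
apply: (@quotient_dim_const _ _ _ _ _ _ 1%:M) => [v|v _|f].
- move=> /sub_kermxP vK; rewrite mulmx1; exists fun0; last exact: extd_0.
  exact: adjoint_const.
- by rewrite mulmx1; exact: const_fun_ae0.
- move=> [g [hf hg fg] g0].
  (* With g = A^*f and Ag = 0, the adjoint relation gives ||g||^2 = 0; f is then orthogonal to the
     range of A. *)
  have gz : ae_equal g fun0.
    by apply: inner_self_eq0 => //; rewrite -(fg _ _ g0) inner0l.
  have [|m hm fm] := @orth_range_const f hf.
    move=> u u' uu'; rewrite (fg _ _ uu').
    have [hu _ _] := uu'.
    rewrite (inner_ae hu hu hg (@L2_0 R G) _ gz) ?inner0r//.
    by move=> e; exact: aeW.
  exists m; first exact/sub_kermxP.
  by rewrite mulmx1; exact: ae_equal_sub0.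
Qed.

Let Pi_idem := projector_mx_idem hP.
Let Pi_herm := projector_mx_herm hP.

(** Whether a form lies in the range depends only on its edge integrals, through [range_space];
    edgewise constant forms with integrals in a complement represent the cokernel. *)
Lemma range_codim_extd :
  range_codim (extd P) (\rank (kermx (As *m (1%:M - Pi)))).
Proof.
set K := range_space (end_mx G false) (end_mx G true) Pi.
rewrite -(rank_range_spaceC I00 I11 I01 (sum_end_mx G) (end_mx_real _ _)
  (end_mx_real _ _) Pi_idem Pi_herm) -/K.
apply: (@quotient_dim_const _ _ _ _ _ _ (inv_len_mx G)) => [v _|v vK|g hg].
- exact: L2_const.
- move=> [f /extdP[_ _ [c _]]]; rewrite integral_row_const => h.
  have vK' : (v <= K)%MS by apply/range_spaceP; exists c.
  apply/eqP; rewrite -submx0 -(capmx_compl K) sub_capmx vK'.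
  exact: vK.
(* Subtracting the constant form that carries the [K^C] part of the integrals leaves a form in the
   range. *)
- have : (integral_row g <= K + K^C)%MS by rewrite submx_full// addsmx_compl_full.
  move=> /sub_addsmxP[[u1 u2] /= e]; exists (u2 *m (K^C)%MS); first exact: submxMl.
  have /range_spaceP[c hc] : (u1 *m K <= K)%MS by exact: submxMl.
  exists (primitive_fun c (sub_fun g (const_fun (u2 *m (K^C)%MS *m inv_len_mx G)))).
  apply: extd_primitive; first by apply: L2B => //; exact: L2_const.
  by rewrite (integral_rowB hg (L2_const _)) integral_row_const e addrK.
Qed.

Lemma kernel_dim_extd : kernel_dim (extd P) (\rank (kermx (Sy *m Pi))).
Proof.
apply: (@quotient_dim_const _ _ _ _ _ _ 1%:M) => [v|v _|f].
- by move=> /sub_kermxP vK; rewrite mulmx1; apply: extd_const; rewrite -mulmxA.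
- by rewrite mulmx1; exact: const_fun_ae0.
- move=> /extdP[_ _ [c fc bc]]; exists c.
    by apply/sub_kermxP; move: bc; rewrite integral_row_0 mul0mx addr0 mulmxA.
  by rewrite mulmx1; apply: ae_equal_sub0; rewrite -primitive_fun_0.
Qed.

End Operators.

(** * The multiplicity formulas *)

Theorem corollary23 (R : realType) (G : quantum_graph R)
    (P : vertex_conditions G)
    (hP : forall v : vertex G, orthogonal_projector (P v)) :
  exists (N0 N0s Nt : nat) (ind : int),
    [/\ kernel_dim (compose (adjoint (extd P)) (extd P)) N0,
        kernel_dim (compose (extd P) (adjoint (extd P))) N0s,
        operator_index (extd P) ind
      & vanishing_order0 (secular P) Nt] /\
    [/\ Nt%:Z = 2%:Z * N0%:Z - ind,
        2%:Z * N0%:Z - ind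
          = 2%:Z * N0%:Z - #|{: edge G}|%:Z + (dirichlet_count P)%:Z
      & Nt = (N0 + N0s)%N].
Proof.
pose Pi := projector_mx P; pose I0 := end_mx G false; pose I1 := end_mx G true.
pose a := \rank (kermx ((I0 + I1) *m Pi)).
pose b := \rank (kermx ((I1 - I0) *m (1%:M - Pi))).
have I00 : I0 *m I0^T = 1%:M by exact: mul_end_mx_tr.
have I11 : I1 *m I1^T = 1%:M by exact: mul_end_mx_tr.
have I01 : I0 *m I1^T = 0 by rewrite mul_end_mx_tr raddf0.
have idx : (a + dirichlet_count P = #|{: edge G}| + b)%N.
  rewrite -(projector_mx_rank hP).
  exact: (rank_ker_index I00 I11 I01 (sum_end_mx G) (end_mx_real _ _)
    (end_mx_real _ _) (projector_mx_idem hP) (projector_mx_herm hP)).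
have ord : vanishing_order0 (secular P) (a + b).
  have := secular_vanishing_order hP.
  by rewrite (reverse_mxE G) (fixed_space_rank I00 I11 I01 (sum_end_mx G)
    (projector_mx_idem hP)).
have k1 : kernel_dim (compose (adjoint (extd P)) (extd P)) a := kernel_dim_AsA P.
have k2 : kernel_dim (compose (extd P) (adjoint (extd P))) b := kernel_dim_AAs hP.
have k3 : kernel_dim (extd P) a := kernel_dim_extd P.
have k4 : range_codim (extd P) b := range_codim_extd hP.
clearbody a b.
(* With N0 = a and N0^* = b the order is a + b = 2a - (a - b), and [idx] gives a - b = E - p. *)
exists a, b, (a + b)%N, (a%:Z - b%:Z); split; first by split=> //; exists a, b.
by split; lia.
Qed.
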